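(* Let $\mathbb{K}$ be a field of characteristic neither $2$ nor $3$, $\overline{\mathbb{K}}$ an algebraic closure, and $n\geq 1$. Let $\mathcal{V}$ be a linear subspace of $M_n(\mathbb{K})$ of dimension $\binom{n}{2}+1$ such that every $M\in\mathcal{V}$ has at most one nonzero eigenvalue in $\overline{\mathbb{K}}$. Then there is a unique non-empty subset $I$ of $\{1,\dots,n\}$ such that $\mathcal{V}$ is similar to $\mathcal{V}^{(1^\star)}_I$.
   Context: $\mathrm{NT}_n(\mathbb{K})$ is the space of strictly upper-triangular $n\times n$ matrices. For non-empty $I\subset\{1,\dots,n\}$, $D_I$ is the diagonal matrix with $(i,i)$ entry $1$ for $i\in I$ and $0$ otherwise, and $\mathcal{V}^{(1^\star)}_I:=\mathbb{K}D_I\oplus\mathrm{NT}_n(\mathbb{K})$. Similar means conjugate by a single invertible matrix in $GL_n(\mathbb{K})$. *)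

(* Defs.v *)
From HB Require Import structures.
From mathcomp Require Import all_boot all_order all_algebra.
Set Implicit Arguments. Unset Strict Implicit. Unset Printing Implicit Defensive.
Import Order.TTheory GRing.Theory Num.Theory.
Local Open Scope ring_scope.

Definition strictly_upper (K : fieldType) (n : nat) (A : 'M[K]_n) : Prop :=
  forall i j : 'I_n, (j <= i)%N -> A i j = 0.

Definition DI (K : fieldType) (n : nat) (I : {set 'I_n}) : 'M[K]_n :=
  diag_mx (\row_i (if i \in I then 1 else 0)).
Arguments DI K {n} I.

Definition inV1star (K : fieldType) (n : nat) (I : {set 'I_n}) (A : 'M[K]_n) : Prop :=
  exists (c : K) (N : 'M[K]_n), strictly_upper N /\ A = c *: DI K I + N.

Definition subspace_similar_to (K : fieldType) (n : nat) (V : {vspace 'M[K]_n})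
    (W : 'M[K]_n -> Prop) : Prop :=
  exists P : 'M[K]_n, P \in unitmx /\
    forall A : 'M[K]_n, (A \in V) <-> W (P *m A *m invmx P).

Definition is_alg_closure (K : fieldType) (L : closedFieldType)
    (f : {rmorphism K -> L}) : Prop :=
  forall x : L, exists p : {poly K}, p != 0 /\ root (map_poly f p) x.

(* Main.v *)
(** If M has at most one nonzero eigenvalue a, of multiplicity k, then
    tr M^i = k a^i for i > 0, so the first two power traces determine all the
    others. Hence tr((v + t w)^i) = tr(v^i) whenever v, w lie in V and tr w = 0;
    extracting coefficients in t (for i <= 4, which is where the characteristic
    enters) and polarising yields trace identities on V.

    Induct on n = 1 + m, with n x n matrices cut into blocks along the first
    coordinate. If X is the space of rows p with [0 p; 0 0] in V, and D the space
    of the lower left columns of V, the identity tr(v w) = 0 makes X and D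
    orthogonal, which gives dim V <= C(n,2) + 1. In the equality case X is the full
    orthogonal of D and, up to a change of basis, every strictly upper triangular
    N of size m lifts to some [0 l; 0 N] in V. If X <> 0, the cubic and quartic
    identities show that D = <e_0, ..., e_(r-1)> with r < m and that the span of
    the first r + 1 basis vectors is V-stable, so V is block triangular and the
    induction hypothesis applies to the two diagonal blocks. If X = 0, the lift of
    the elementary matrix E_(0,m-1) is a nilpotent of rank one; taking its image as
    the first basis line leads back to X <> 0. A triangular V of maximal dimension
    consists of NT_n and a line of diagonal matrices, whose support is I.

    For uniqueness, a base change between two of the model spaces normalises NT_n,
    hence is upper triangular, and so preserves diagonals. *)

Require Import Defs.
From HB Require Import structures.
From mathcomp Require Import all_boot all_order all_algebra.
From mathcomp Require Import ring zify.
Set Implicit Arguments. Unset Strict Implicit. Unset Printing Implicit Defensive.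
Import Order.TTheory GRing.Theory Num.Theory.
Local Open Scope ring_scope.

(** * Conjugation and characteristic polynomials *)

Definition conjm (K : fieldType) n (P M : 'M[K]_n) : 'M[K]_n :=
  P *m M *m invmx P.

Lemma conjm_linear (K : fieldType) n (P : 'M[K]_n) : linear (conjm P).
Proof.
by move=> a A B; rewrite /conjm mulmxDr mulmxDl -scalemxAr -scalemxAl.
Qed.

HB.instance Definition _ (K : fieldType) n (P : 'M[K]_n) :=
  GRing.isLinear.Build K 'M[K]_n 'M[K]_n _ (conjm P) (conjm_linear P).

Lemma conjmM (K : fieldType) n (P A B : 'M[K]_n) : P \in unitmx ->
  conjm P (A *m B) = conjm P A *m conjm P B.
Proof. by move=> uP; rewrite /conjm !mulmxA mulmxKV. Qed.

Lemma conjm1 (K : fieldType) n (P : 'M[K]_n) : P \in unitmx ->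
  conjm P 1%:M = 1%:M.
Proof. by move=> uP; rewrite /conjm mulmx1 mulmxV. Qed.

Lemma conjmK (K : fieldType) n (P : 'M[K]_n) : P \in unitmx ->
  cancel (conjm P) (conjm (invmx P)).
Proof. by move=> uP A; rewrite /conjm invmxK !mulmxA mulVmx // mul1mx mulmxKV. Qed.

Lemma conjmVK (K : fieldType) n (P : 'M[K]_n) : P \in unitmx ->
  cancel (conjm (invmx P)) (conjm P).
Proof. by move=> uP A; rewrite -{1}[P]invmxK conjmK ?unitmx_inv. Qed.

Lemma invmx_uniq (K : fieldType) n (P R : 'M[K]_n) :
  P *m R = 1%:M -> invmx P = R.
Proof. by move=> PR; have [uP _] := mulmx1_unit PR; rewrite -(mulKmx uP R) PR mulmx1. Qed.

Lemma conjm_comp (K : fieldType) n (P R A : 'M[K]_n) :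
  P \in unitmx -> R \in unitmx -> conjm P (conjm R A) = conjm (P *m R) A.
Proof.
move=> uP uR; rewrite /conjm (@invmx_uniq _ _ (P *m R) (invmx R *m invmx P)) ?mulmxA //.
by rewrite mulmxK // mulmxV.
Qed.

Lemma mxtrace_conjm (K : fieldType) n (P A : 'M[K]_n) : P \in unitmx ->
  \tr (conjm P A) = \tr A.
Proof. by move=> uP; rewrite /conjm mxtrace_mulC mulmxA mulVmx ?mul1mx. Qed.

Lemma char_poly_conjm (K : fieldType) n (P A : 'M[K]_n) : P \in unitmx ->
  char_poly (conjm P A) = char_poly A.
Proof.
move=> uP; rewrite /char_poly /char_poly_mx.
have uPX : map_mx polyC P \in unitmx by rewrite map_unitmx.
have -> : 'X%:M - map_mx polyC (conjm P A) =
    map_mx polyC P *m ('X%:M - map_mx polyC A) *m map_mx polyC (invmx P).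
  rewrite mulmxBr mulmxBl -!map_mxM /conjm; congr (_ - _).
  rewrite scalar_mxC -mulmxA -map_mxM mulmxV // map_scalar_mx.
  by rewrite mulmx1.
rewrite !det_mulmx mulrC mulrA -det_mulmx -map_mxM mulVmx // map_mx1 det1.
by rewrite mul1r.
Qed.

Lemma char_poly_ublock (K : fieldType) n1 n2 (A : 'M[K]_n1) (B : 'M[K]_(n1, n2))
    (D : 'M[K]_n2) :
  char_poly (block_mx A B 0 D) = char_poly A * char_poly D.
Proof.
rewrite /char_poly /char_poly_mx map_block_mx scalar_mx_block opp_block_mx.
by rewrite add_block_mx map_mx0 subr0 det_ublock.
Qed.

Lemma char_poly_scalar1 (K : fieldType) (A : 'M[K]_1) :
  char_poly A = 'X - (A 0 0)%:P.
Proof. by rewrite /char_poly det_mx11 !mxE eqxx mulr1n. Qed.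

Lemma col_to_e0 (K : fieldType) n (x : 'cV[K]_(1 + n)) : x != 0 ->
  exists2 P : 'M[K]_(1 + n), P \in unitmx & P *m x = col_mx 1%:M 0.
Proof.
move=> nzx; have rx : \rank x = 1%N.
  by apply/eqP; rewrite eqn_leq rank_leq_col lt0n mxrank_eq0.
have := mulmx_ebase x; rewrite rx.
set C := col_ebase x; set d := row_ebase x => defx.
have uC : C \in unitmx by rewrite col_ebase_unit.
have ud : d \in unitmx by rewrite row_ebase_unit.
have nzd : d 0 0 != 0 by move: ud; rewrite unitmxE det_mx11 unitfE.
exists ((d 0 0)^-1 *: invmx C).
  by rewrite unitmxZ ?unitfE ?invr_eq0 // unitmx_inv.
rewrite -defx (mx11_scalar d) mul_mx_scalar -scalemxAl -scalemxAr scalerA.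
rewrite [(d 0 0)%:M 0 0]mxE eqxx mulr1n mulVf // scale1r mulKmx //; apply/colP=> i; rewrite !mxE.
by case: splitP => j -> //=; rewrite ?ord1 ?mxE //= ?andbF.
Qed.

Definition mxpow (K : fieldType) n (A : 'M[K]_n) k := iter k (mulmx A) 1%:M.

Lemma mxpow_conjm (K : fieldType) n (P A : 'M[K]_n) k : P \in unitmx ->
  mxpow (conjm P A) k = conjm P (mxpow A k).
Proof.
by move=> uP; elim: k => [|k IH]; rewrite /mxpow /= ?conjm1 // conjmM // -IH.
Qed.

Lemma mxpow_ublock (K : fieldType) n1 n2 (A : 'M[K]_n1) (B : 'M[K]_(n1, n2))
    (D : 'M[K]_n2) k :
  exists C, mxpow (block_mx A B 0 D) k = block_mx (mxpow A k) C 0 (mxpow D k).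
Proof.
elim: k => [|k [C IH]]; first by exists 0; rewrite /mxpow /= -scalar_mx_block.
exists (A *m C + B *m mxpow D k); rewrite /mxpow /= -!/(mxpow _ _) IH.
by rewrite mulmx_block !mulmx0 !mul0mx !addr0 add0r.
Qed.

Lemma mxpow_map (K : fieldType) (L : fieldType) (f : {rmorphism K -> L}) n
  (A : 'M[K]_n) k : mxpow (map_mx f A) k = map_mx f (mxpow A k).
Proof.
by elim: k => [|k IH]; rewrite /mxpow /= ?map_mx1 // map_mxM -IH.
Qed.

Lemma eigen_seq (L : closedFieldType) n (M : 'M[L]_n) :
  exists s : seq L, char_poly M = \prod_(x <- s) ('X - x%:P) /\
    forall k, \tr (mxpow M k) = \sum_(x <- s) x ^+ k.
Proof.
elim: n M => [|n IH] M.
  exists [::]; split=> [|k]; rewrite big_nil.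
    by rewrite /char_poly det_mx00.
  by rewrite /mxtrace big_ord0.
suff step (N : 'M[L]_(1 + n)) : exists s : seq L,
    char_poly N = \prod_(x <- s) ('X - x%:P) /\ 
    forall k, \tr (mxpow N k) = \sum_(x <- s) x ^+ k by exact: step.
move: N => {}M; have /closed_rootP [a] : size (char_poly M^T) != 1 by rewrite size_char_poly.
rewrite -eigenvalue_root_char => /eigenvalueP [v ev nzv].
have nzvT : (v^T : 'cV_(1 + n)) != 0.
  by rewrite -(inj_eq trmx_inj) trmxK linear0.
have [P uP Pv] := col_to_e0 nzvT.
have evT : M *m v^T = a *: v^T by rewrite -[M]trmxK -trmx_mul ev linearZ.
have defv : v^T = invmx P *m col_mx 1%:M 0 by rewrite -Pv mulKmx.
pose N : 'M_(1 + n) := conjm P M.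
have Ne : N *m col_mx (1%:M : 'M_1) 0 = a *: col_mx 1%:M 0.
  by rewrite /N /conjm -mulmxA -defv -mulmxA evT -scalemxAr Pv.
have defN : N = block_mx a%:M (ursubmx N) 0 (drsubmx N).
  rewrite -[in LHS](submxK N); move: Ne.
  rewrite -{1}(submxK N) mul_block_col !mulmx1 !mulmx0 !addr0 scale_col_mx.
  by rewrite scaler0 => /eq_col_mx [-> ->]; rewrite scalemx1.
have [s [cs ts]] := IH (drsubmx N).
exists (a :: s); split=> [|k].
  rewrite big_cons -cs -(char_poly_conjm M uP) [conjm P M]defN.
  by rewrite char_poly_ublock char_poly_scalar1 mxE eqxx mulr1n.
rewrite big_cons -ts -(mxtrace_conjm _ uP) -mxpow_conjm // [conjm P M]defN.
have [C ->] := mxpow_ublock (a%:M : 'M_1) (ursubmx N) (drsubmx N) k.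
rewrite mxtrace_block; congr (_ + _).
elim: k => [|k IHk]; first by rewrite /mxpow /= mxtrace1.
by rewrite /mxpow /= mul_scalar_mx mxtraceZ exprS -IHk.
Qed.

(** * Trace identities *)

Section TraceIdentities.

Variables (K : fieldType) (L : closedFieldType) (f : {rmorphism K -> L}).
Hypotheses (nz2 : 2%:R != 0 :> K) (nz3 : 3%:R != 0 :> K).

Definition one_eigen n (M : 'M[K]_n) : Prop :=
  forall a b : L, a != 0 -> b != 0 ->
    root (map_poly f (char_poly M)) a -> root (map_poly f (char_poly M)) b ->
    a = b.

Definition nil_eigen n (M : 'M[K]_n) : Prop :=
  forall a : L, root (map_poly f (char_poly M)) a -> a = 0.

Definition one_eigen_space n (V : {vspace 'M[K]_n}) : Prop :=
  forall M, M \in V -> one_eigen M.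

Lemma one_eigen_power_sums n (M : 'M[K]_n) : one_eigen M ->
  exists (k a : L), forall i, f (\tr (mxpow M i.+1)) = k * a ^+ i.+1.
Proof.
move=> qM; have [s [cs ts]] := eigen_seq (map_mx f M).
have rs x : x \in s -> root (map_poly f (char_poly M)) x.
  by move=> xs; rewrite map_char_poly cs root_prod_XsubC.
have tr_s i : f (\tr (mxpow M i.+1)) = \sum_(x <- s) x ^+ i.+1.
  by rewrite -ts mxpow_map trace_map_mx.
case: (altP (@hasP _ (fun x => x != 0) s)) => [[a sa nza] | /hasPn s0].
  exists (\sum_(x <- s) (x == a)%:R), a => i; rewrite tr_s mulr_suml.
  apply: eq_big_seq => x sx; have [-> | neq_xa] := eqVneq x a; first by rewrite mul1r.
  have [-> | nzx] := eqVneq x 0; first by rewrite expr0n mul0r.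
  by rewrite (qM x a) ?rs ?eqxx in neq_xa.
exists 0, 0 => i; rewrite tr_s mul0r big1_seq // => x /andP [_ /s0].
by rewrite negbK => /eqP ->; rewrite expr0n.
Qed.

Lemma one_eigen_traces0 n (M : 'M[K]_n) i : one_eigen M ->
  \tr M = 0 -> \tr (mxpow M i.+1) = 0.
Proof.
move=> /one_eigen_power_sums [k [a ka]] trM.
have /eqP : f (\tr M) = k * a by rewrite -{1}[M]mulmx1 (ka 0%N).
rewrite trM rmorph0 eq_sym => /eqP ka0; apply: (fmorph_inj f).
by rewrite ka exprS mulrA ka0 mul0r rmorph0.
Qed.

Lemma one_eigen_trace0 n (M : 'M[K]_n) : one_eigen M ->
  \tr (M *m M) = 0 -> \tr M = 0.
Proof.
move=> /one_eigen_power_sums [k [a ka]] trM.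
have e1 : f (\tr M) = k * a by rewrite -{1}[M]mulmx1 (ka 0%N).
have := ka 1%N; rewrite /mxpow /= mulmx1 trM rmorph0 => /esym/eqP.
rewrite mulf_eq0 expf_eq0 /= -mulf_eq0 -e1 => /eqP e0.
by apply: (fmorph_inj f); rewrite e0 rmorph0.
Qed.

Lemma one_eigen_traces_eq n (M N : 'M[K]_n) i : one_eigen M -> one_eigen N ->
  \tr M = \tr N -> \tr (M *m M) = \tr (N *m N) ->
  \tr (mxpow M i.+1) = \tr (mxpow N i.+1).
Proof.
move=> /one_eigen_power_sums [k [a ka]] /one_eigen_power_sums [l [b lb]] e1 e2.
have {}e1 : k * a = l * b.
  by rewrite -[a]expr1 -[b]expr1 -ka -lb /mxpow /= !mulmx1 e1.
have {}e2 : k * a ^+ 2 = l * b ^+ 2 by rewrite -ka -lb /mxpow /= !mulmx1 e2.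
apply: (fmorph_inj f); rewrite ka lb !exprS !mulrA -e1.
have /eqP : (k * a) * (a - b) = 0 by rewrite mulrBr {2}e1 -!mulrA -!expr2 e2 subrr.
by rewrite mulf_eq0 subr_eq0 => /orP [] /eqP ->; rewrite ?mul0r.
Qed.

Lemma mxtrace2_add n (v x : 'M[K]_n) :
  \tr ((v + x) *m (v + x)) = \tr (v *m v) + 2 * \tr (v *m x) + \tr (x *m x).
Proof.
rewrite !(mulmxDl, mulmxDr) !mxtraceD [\tr (x *m v)]mxtrace_mulC; ring.
Qed.

Lemma mxtrace3_add n (v x : 'M[K]_n) :
  \tr (mxpow (v + x) 3) = \tr (mxpow v 3) + 3 * \tr (v *m v *m x)
     + 3 * \tr (v *m x *m x) + \tr (mxpow x 3).
Proof.
rewrite /mxpow /= !mulmx1 !(mulmxDl, mulmxDr) !mulmxA !mxtraceD.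
have -> : \tr (x *m v *m v) = \tr (v *m v *m x) by rewrite -mulmxA mxtrace_mulC.
have -> : \tr (v *m x *m v) = \tr (v *m v *m x) by rewrite mxtrace_mulC mulmxA.
have -> : \tr (x *m v *m x) = \tr (v *m x *m x) by rewrite -mulmxA mxtrace_mulC.
have -> : \tr (x *m x *m v) = \tr (v *m x *m x) by rewrite mxtrace_mulC mulmxA.
ring.
Qed.

Lemma mxtrace4_add n (v x : 'M[K]_n) :
  \tr (mxpow (v + x) 4) = \tr (mxpow v 4) + 4 * \tr (v *m v *m v *m x)
     + (4 * \tr (v *m v *m x *m x) + 2 * \tr (v *m x *m v *m x))
     + 4 * \tr (v *m x *m x *m x) + \tr (mxpow x 4).
Proof.
have rot (a b c d : 'M[K]_n) :
    \tr (a *m b *m c *m d) = \tr (b *m c *m d *m a).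
  by rewrite -!mulmxA mxtrace_mulC !mulmxA.
rewrite /mxpow /= !mulmx1 !(mulmxDl, mulmxDr) !mulmxA !mxtraceD.
have -> : \tr (v *m v *m x *m v) = \tr (v *m v *m v *m x) by rewrite -(rot v v v x).
have -> : \tr (v *m x *m v *m v) = \tr (v *m v *m v *m x) by rewrite -(rot v v x v) -(rot v v v x).
have -> : \tr (x *m v *m v *m v) = \tr (v *m v *m v *m x) by rewrite -(rot v x v v) -(rot v v x v) -(rot v v v x).
have -> : \tr (v *m x *m x *m v) = \tr (v *m v *m x *m x) by rewrite -(rot v v x x).
have -> : \tr (x *m x *m v *m v) = \tr (v *m v *m x *m x) by rewrite -(rot v x x v) -(rot v v x x).
have -> : \tr (x *m v *m v *m x) = \tr (v *m v *m x *m x) by rewrite -(rot x x v v) -(rot v x x v) -(rot v v x x).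
have -> : \tr (x *m v *m x *m v) = \tr (v *m x *m v *m x) by rewrite -(rot v x v x).
have -> : \tr (x *m x *m x *m v) = \tr (v *m x *m x *m x) by rewrite -(rot v x x x).
have -> : \tr (x *m x *m v *m x) = \tr (v *m x *m x *m x) by rewrite -(rot x x x v) -(rot v x x x).
have -> : \tr (x *m v *m x *m x) = \tr (v *m x *m x *m x) by rewrite -(rot x x v x) -(rot x x x v) -(rot v x x x).
ring.
Qed.

Lemma mxpowZ n (t : K) (v : 'M[K]_n) k : mxpow (t *: v) k = t ^+ k *: mxpow v k.
Proof.
elim: k => [|k IH]; first by rewrite expr0 scale1r.
by rewrite /mxpow /= -/(mxpow _ _) IH -scalemxAl -scalemxAr scalerA exprS.
Qed.

Variables (n : nat) (V : {vspace 'M[K]_n}).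
Hypothesis QV : one_eigen_space V.

Lemma one_eigen_trace2 v w : v \in V -> w \in V -> \tr w = 0 ->
  \tr (v *m w) = 0.
Proof.
move=> Vv Vw trw; apply/eqP/negPn/negP => nz.
have trww : \tr (w *m w) = 0.
  by have := one_eigen_traces0 1 (QV Vw) trw; rewrite /mxpow /= mulmx1.
have tr0 t : \tr (v *m v) + 2 * t * \tr (v *m w) = 0 -> \tr v = 0.
  move=> e; have := @one_eigen_trace0 _ (v + t *: w) (QV _).
  rewrite mxtraceD mxtraceZ trw mulr0 addr0; apply; first by rewrite rpredD ?rpredZ.
  rewrite mxtrace2_add -!scalemxAr -scalemxAl !mxtraceZ trww !mulr0 addr0.
  by rewrite -e; ring.
have trv : \tr v = 0.
  apply: (tr0 (- \tr (v *m v) / (2 * \tr (v *m w)))); field.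
  by rewrite nz nz2.
have trM M : M \in V -> \tr M = 0 -> \tr (M *m M) = 0.
  by move=> VM /(one_eigen_traces0 1 (QV VM)); rewrite /mxpow /= mulmx1.
have := trM (v + w) (rpredD Vv Vw); rewrite mxtraceD trv trw addr0 => /(_ erefl).
rewrite mxtrace2_add !trM // add0r addr0 => /eqP.
by rewrite mulf_eq0 (negPf nz2) (negPf nz).
Qed.

Lemma one_eigen_traces_shift v w t i : v \in V -> w \in V -> \tr w = 0 ->
  \tr (mxpow (v + t *: w) i.+1) = \tr (mxpow v i.+1).
Proof.
move=> Vv Vw trw; apply: one_eigen_traces_eq; try exact: QV.
- by apply: QV; rewrite rpredD ?rpredZ.
- by rewrite mxtraceD mxtraceZ trw mulr0 addr0.
rewrite mxtrace2_add -!scalemxAr -scalemxAl !mxtraceZ.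
by rewrite !(one_eigen_trace2 _ Vw) // !mulr0 !addr0.
Qed.

Lemma one_eigen_trace3 v w : v \in V -> w \in V -> \tr w = 0 ->
  \tr (v *m v *m w) = 0.
Proof.
move=> Vv Vw trw; set A := \tr _.
have e t : 3 * t * A + 3 * t ^+ 2 * \tr (v *m w *m w) = 0.
  have := one_eigen_traces_shift t 2 Vv Vw trw.
  rewrite mxtrace3_add mxpowZ -!(scalemxAr, scalemxAl) !mxtraceZ.
  rewrite (one_eigen_traces0 _ (QV Vw) trw) mulr0 addr0 -addrA.
  rewrite -[RHS]addr0 => /addrI e0; rewrite -[RHS]e0 /A; ring.
have /eqP : 2 * 3 * A = 0.
  transitivity ((3 * 1 * A + 3 * 1 ^+ 2 * \tr (v *m w *m w)) -
    (3 * - 1 * A + 3 * (- 1) ^+ 2 * \tr (v *m w *m w))); first by ring.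
  by rewrite !e subrr.
by rewrite !mulf_eq0 (negPf nz2) (negPf nz3) => /eqP.
Qed.

Lemma one_eigen_trace4 v w : v \in V -> w \in V -> \tr w = 0 ->
  \tr (v *m v *m v *m w) = 0.
Proof.
move=> Vv Vw trw; set A := \tr _.
pose B := 4 * \tr (v *m v *m w *m w) + 2 * \tr (v *m w *m v *m w).
pose C := \tr (v *m w *m w *m w).
have e t : 4 * t * A + t ^+ 2 * B + 4 * t ^+ 3 * C = 0.
  have := one_eigen_traces_shift t 3 Vv Vw trw.
  rewrite mxtrace4_add mxpowZ -!(scalemxAr, scalemxAl) !mxtraceZ.
  rewrite (one_eigen_traces0 _ (QV Vw) trw) mulr0 addr0 -!addrA.
  rewrite -[RHS]addr0 => /addrI e0; rewrite -[RHS]e0 /A /B /C; ring.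
have /eqP : 2 * 2 * 2 * 3 * A = 0.
  have e1 := e 1; have e2 := e (- 1); have e3 := e 2.
  transitivity (4 * ((4 * 1 * A + 1 ^+ 2 * B + 4 * 1 ^+ 3 * C)
     - (4 * - 1 * A + (- 1) ^+ 2 * B + 4 * (- 1) ^+ 3 * C))
     - (4 * 2 * A + 2 ^+ 2 * B + 4 * 2 ^+ 3 * C) 
     + 2 * ((4 * 1 * A + 1 ^+ 2 * B + 4 * 1 ^+ 3 * C)
     + (4 * - 1 * A + (- 1) ^+ 2 * B + 4 * (- 1) ^+ 3 * C))); first by ring.
  by rewrite !e; ring.
by rewrite !mulf_eq0 (negPf nz2) (negPf nz3) => /eqP.
Qed.

Lemma one_eigen_trace3_polar u v w : u \in V -> v \in V -> w \in V ->
  \tr w = 0 -> \tr ((u *m v + v *m u) *m w) = 0.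
Proof.
move=> Vu Vv Vw trw.
have := one_eigen_trace3 (rpredD Vu Vv) Vw trw.
have Eu := one_eigen_trace3 Vu Vw trw; have Ev := one_eigen_trace3 Vv Vw trw.
rewrite !(mulmxDl, mulmxDr) !mxtraceD Eu Ev => e; rewrite -[RHS]e; ring.
Qed.

Lemma one_eigen_trace4_polar u v z w : u \in V -> v \in V -> z \in V ->
  w \in V -> \tr w = 0 ->
  \tr ((u *m v *m z + u *m z *m v + v *m u *m z + v *m z *m u + z *m u *m v
        + z *m v *m u) *m w) = 0.
Proof.
move=> Vu Vv Vz Vw trw.
have T x (Vx : x \in V) := one_eigen_trace4 Vx Vw trw.
have := T _ (rpredD (rpredD Vu Vv) Vz).
have := T _ (rpredD Vu Vv); have := T _ (rpredD Vu Vz).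
have := T _ (rpredD Vv Vz); have := T _ Vu; have := T _ Vv; have := T _ Vz.
rewrite !(mulmxDl, mulmxDr) !mxtraceD => e1 e2 e3 e4 e5 e6 e7.
rewrite !(e1, e2, e3) in e4 e5 e6 e7 *.
have := congr2 (fun x y => x - y) e7 (congr2 +%R (congr2 +%R e4 e5) e6).
rewrite /= !addr0 subrr => e8; rewrite -[RHS]e8; ring.
Qed.

End TraceIdentities.

(** * Triangular spaces of maximal dimension *)

Definition upper (K : fieldType) n (A : 'M[K]_n) : Prop :=
  forall i j : 'I_n, (j < i)%N -> A i j = 0.

Lemma strictly_upperP (K : fieldType) n (A : 'M[K]_n) :
  strictly_upper A <-> upper A /\ forall i, A i i = 0.
Proof.
split=> [suA | [uA A0] i j]; first by split=> [i j ltji | i]; apply: suA; rewrite // ltnW.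
by rewrite leq_eqVlt => /predU1P [/val_inj -> | /uA]; rewrite ?A0.
Qed.

Lemma scaler_DI (K : fieldType) n (I : {set 'I_n}) (c : K) i j :
  (c *: DI K I) i j = c * ((i == j) && (i \in I))%:R.
Proof.
by rewrite !mxE; case: eqP => [->|] //=; case: (j \in I); rewrite ?mulr1n ?mulr0n.
Qed.

Lemma card_ltn_pairs n : #|[set p : 'I_n * 'I_n | (p.2 < p.1)%N]| = 'C(n, 2).
Proof.
rewrite -bin2_sum big_mkord -sum1dep_card.
transitivity (\sum_(j < n) \sum_(i < n | (i < j)%N) 1)%N; first by rewrite pair_big_dep.
apply: eq_bigr => j _; rewrite -(big_ord_widen _ (fun=> 1%N)) ?sum1_card ?card_ord //.
exact: ltnW.
Qed.

Lemma dimv_strictly_upper (K : fieldType) n (V : {vspace 'M[K]_n}) :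
  (forall M, M \in V -> strictly_upper M) ->
  (\dim V <= 'C(n, 2))%N /\
  (\dim V = 'C(n, 2) -> forall N, strictly_upper N -> N \in V).
Proof.
move=> suV; pose A := [set p : 'I_n * 'I_n | (p.2 < p.1)%N].
pose g (M : 'M[K]_n) : 'rV[K]_#|A| := \row_k M (enum_val k).2 (enum_val k).1.
have lin_g : linear g by move=> a M N; apply/rowP=> k; rewrite !mxE.
pose gl : {linear 'M[K]_n -> 'rV[K]_#|A|} :=
  HB.pack g (GRing.isLinear.Build K _ _ _ g lin_g).
pose G := linfun gl.
have inj_g M N : strictly_upper M -> strictly_upper N -> g M = g N -> M = N.
  move=> suM suN /rowP eMN; apply/matrixP=> i j.
  have [le_ji | lt_ij] := leqP j i; first by rewrite suM ?suN.
  have Aji : (j, i) \in A by rewrite inE.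
  by have := eMN (enum_rank_in Aji (j, i)); rewrite !mxE enum_rankK_in.
have dG : \dim (G @: V) = \dim V.
  apply: limg_dim_eq; apply/eqP; rewrite -subv0; apply/subvP=> M.
  rewrite memv_cap memv_ker lfunE /= memv0 => /andP [/suV suM /eqP gM].
  by apply/eqP/inj_g => // [i j _|]; rewrite ?gM ?mxE //; apply/rowP=> k; rewrite !mxE.
have dF : \dim {: 'rV[K]_#|A|} = 'C(n, 2).
  by rewrite dimvf /dim /= mul1n card_ltn_pairs.
split=> [|eqd N suN]; first by rewrite -dG -dF dimvS // subvf.
have /eqP defG : (G @: V == fullv)%VS by rewrite eqEdim subvf dG eqd dF /=.
have /memv_imgP [M VM eNM] : G N \in (G @: V)%VS by rewrite defG memvf.
by rewrite (inj_g N M) //; [apply: suV | move: eNM; rewrite !lfunE].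
Qed.

Definition conjv (K : fieldType) n (P : 'M[K]_n) (V : {vspace 'M[K]_n}) :=
  (linfun (conjm P) @: V)%VS.

Lemma memv_conjv (K : fieldType) n (P A : 'M[K]_n) (V : {vspace 'M[K]_n}) :
  P \in unitmx -> (A \in conjv P V) = (conjm (invmx P) A \in V).
Proof.
move=> uP; apply/memv_imgP/idP => [[M VM ->] | VA].
  by rewrite lfunE /= conjmK.
exists (conjm (invmx P) A) => //; rewrite lfunE /=.
by rewrite conjmVK.
Qed.

Lemma conjm_conjv (K : fieldType) n (P A : 'M[K]_n) (V : {vspace 'M[K]_n}) :
  A \in V -> conjm P A \in conjv P V.
Proof. by move=> VA; apply/memv_imgP; exists A; rewrite ?lfunE. Qed.

Lemma dimv_conjv (K : fieldType) n (P : 'M[K]_n) (V : {vspace 'M[K]_n}) :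
  P \in unitmx -> \dim (conjv P V) = \dim V.
Proof.
move=> uP; apply: limg_dim_eq; apply/eqP; rewrite -subv0; apply/subvP=> M.
rewrite memv_cap memv_ker lfunE /= memv0 => /andP [_ /eqP cM].
by rewrite -(conjmK uP M) cM linear0.
Qed.

Lemma char_poly_upper (K : fieldType) n (A : 'M[K]_n) : upper A ->
  char_poly A = \prod_(i < n) ('X - (A i i)%:P).
Proof.
move=> uA; have -> : char_poly A = char_poly A^T.
  rewrite /char_poly -[LHS]det_tr; congr (\det _).
  by apply/matrixP=> i j; rewrite !mxE eq_sym.
rewrite char_poly_trig; first by apply: eq_bigr => i _; rewrite mxE.
by apply/is_trig_mxP => i j /uA; rewrite mxE.
Qed.

Section Spectrum.

Variables (K : fieldType) (L : closedFieldType) (f : {rmorphism K -> L}).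
Hypotheses (nz2 : 2%:R != 0 :> K).

Notation one_eigen := (one_eigen f).
Notation nil_eigen := (nil_eigen f).
Notation one_eigen_space := (one_eigen_space f).

Lemma one_eigen_conjm n (P M : 'M[K]_n) : P \in unitmx ->
  one_eigen M -> one_eigen (conjm P M).
Proof. by move=> uP qM a b; rewrite char_poly_conjm //; apply: qM. Qed.

Lemma nil_eigen_conjm n (P M : 'M[K]_n) : P \in unitmx ->
  nil_eigen M -> nil_eigen (conjm P M).
Proof. by move=> uP qM a; rewrite char_poly_conjm //; apply: qM. Qed.

Lemma one_eigen_conjv n (P : 'M[K]_n) V : P \in unitmx ->
  one_eigen_space V -> one_eigen_space (conjv P V).
Proof.
move=> uP QV M; rewrite memv_conjv // => /QV /(one_eigen_conjm uP).
by rewrite conjmVK.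
Qed.

Lemma root_char_upper n (M : 'M[K]_n) i : upper M ->
  root (map_poly f (char_poly M)) (f (M i i)).
Proof.
move=> /char_poly_upper ->; rewrite rmorph_prod /= (bigD1 i) //= rootM.
by rewrite map_polyXsubC root_XsubC eqxx.
Qed.

Lemma nil_eigen_upper n (M : 'M[K]_n) : upper M -> nil_eigen M ->
  strictly_upper M.
Proof.
move=> uM nM; apply/strictly_upperP; split=> // i; apply/eqP.
by rewrite -(fmorph_eq0 f) (nM _ (root_char_upper i uM)).
Qed.

Lemma one_eigen_upper n (M : 'M[K]_n) i j : upper M -> one_eigen M ->
  M i i != 0 -> M j j != 0 -> M i i = M j j.
Proof.
move=> uM qM nzi nzj; apply: (fmorph_inj f).
by apply: qM; rewrite ?fmorph_eq0 ?root_char_upper.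
Qed.

Lemma one_neq_opp : 1 != - 1 :> K.
Proof. by rewrite -subr_eq0 opprK. Qed.

Lemma root_char_shift n (M : 'M[K]_n) c a :
  root (map_poly f (char_poly (M + c%:M))) a =
  root (map_poly f (char_poly M)) (a - f c).
Proof.
rewrite !map_char_poly -!eigenvalue_root_char map_mxD map_scalar_mx.
apply/eigenvalueP/eigenvalueP => - [v ev nzv]; exists v => //.
  by rewrite scalerBl -ev mulmxDr mul_mx_scalar addrK.
by rewrite mulmxDr ev mul_mx_scalar -scalerDl subrK.
Qed.

Lemma max_upper_space n (V : {vspace 'M[K]_n}) : one_eigen_space V ->
  (forall M, M \in V -> upper M) -> \dim V = 'C(n, 2).+1 ->
  exists I : {set 'I_n}, I != set0 /\ forall A, A \in V <-> inV1star I A.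
Proof.
move=> QV uV dV.
pose g (M : 'M[K]_n) : 'rV[K]_n := \row_i M i i.
have lin_g : linear g by move=> a M N; apply/rowP=> k; rewrite !mxE.
pose gl : {linear 'M[K]_n -> 'rV[K]_n} :=
  HB.pack g (GRing.isLinear.Build K _ _ _ g lin_g).
pose G := linfun gl.
pose N0 := (V :&: lker G)%VS.
have suN0 M : M \in N0 -> strictly_upper M.
  rewrite memv_cap memv_ker lfunE /= => /andP [VM /eqP/rowP gM].
  by apply/strictly_upperP; split=> [|i]; [apply: uV | have := gM i; rewrite !mxE].
have [leN eqN] := dimv_strictly_upper suN0.
have dN := limg_ker_dim G V; rewrite -/N0 dV in dN.
pose ind (I : {set 'I_n}) : 'rV[K]_n := \row_i (i \in I)%:R.
have qG x i j : x \in (G @: V)%VS -> x 0 i != 0 -> x 0 j != 0 -> x 0 i = x 0 j.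
  move=> /memv_imgP [M VM ->]; rewrite lfunE /= !mxE.
  by apply: one_eigen_upper; [apply: uV | apply: QV].
have indG x : x \in (G @: V)%VS -> x != 0 ->
    exists I c, [/\ I != set0, c != 0 & x = c *: ind I].
  move=> Gx nzx; pose I := [set i | x 0 i != 0].
  have /rV0Pn [i nzi] := nzx; exists I, (x 0 i); split=> //.
    by apply/set0Pn; exists i; rewrite inE.
  apply/rowP=> j; rewrite !mxE inE; case: eqVneq => [-> | nzj]; first by rewrite mulr0.
  by rewrite mulr1; apply: qG.
have subI I J : I != set0 -> J != set0 -> ind I \in (G @: V)%VS ->
    ind J \in (G @: V)%VS -> I \subset J.
  move=> nI /set0Pn [j Jj] GI GJ; apply/subsetP=> i Ii; apply: contraT => nJi.
  have [Ij | nIj] := boolP (j \in I).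
    have := qG _ i j (rpredD GI GJ); rewrite !mxE Ii Ij (negPf nJi) Jj addr0.
    move=> /(_ (oner_neq0 _) nz2) /eqP; rewrite eq_sym -subr_eq0 addrK.
    by rewrite oner_eq0.
  have := qG _ i j (rpredB GI GJ); rewrite !mxE Ii (negPf nIj) (negPf nJi) Jj.
  rewrite subr0 sub0r oppr_eq0 => /(_ (oner_neq0 _) (oner_neq0 _)) /eqP.
  by rewrite (negPf one_neq_opp).
have nzG : (G @: V)%VS != 0%VS.
  by rewrite -dimv_eq0 -lt0n -(ltn_add2l (\dim N0)) addn0 dN ltnS.
have [I [nzI GI]] : exists I, I != set0 /\ ind I \in (G @: V)%VS.
  have := memv_pick (G @: V)%VS; have := nzG; rewrite -vpick0.
  move=> nzx Gx; have [I [c [nI nzc e]]] := indG _ Gx nzx.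
  by exists I; split=> //; move: Gx; rewrite e rpredZeq (negPf nzc).
have lineG x : x \in (G @: V)%VS -> exists c, x = c *: ind I.
  move=> Gx; have [-> | nzx] := eqVneq x 0; first by exists 0; rewrite scale0r.
  have [J [c [nJ nzc e]]] := indG _ Gx nzx; exists c; rewrite e.
  have GJ : ind J \in (G @: V)%VS by move: Gx; rewrite e rpredZeq (negPf nzc).
  by congr (_ *: ind _); apply/eqP; rewrite eqEsubset !subI.
have dG1 : (\dim (G @: V) <= 1)%N.
  apply: (@leq_trans (\dim <[ind I]>)); last by rewrite dim_vline; case: eqP.
  apply: dimvS; apply/subvP=> x /lineG [c ->].
  exact: memvZ (memv_line _).
have dN0 : \dim N0 = 'C(n, 2).
  apply/eqP; rewrite eqn_leq leN -ltnS -dN -[(\dim N0).+1]addn1 leq_add2l.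
  exact: dG1.
have NV N : strictly_upper N -> N \in V.
  by move=> /(eqN dN0); rewrite memv_cap => /andP [].
have g_su A c : upper A -> g A = c *: ind I -> strictly_upper (A - c *: DI K I).
  move=> uA gA; apply/strictly_upperP; split=> [i j lt_ji | i].
    by rewrite mxE uA // mxE scaler_DI -val_eqE /= gtn_eqF // mulr0 oppr0 addr0.
  have := congr1 (fun x : 'rV_n => x 0 i) gA.
  rewrite [g A 0 i]mxE [(A - _) i i]mxE [X in _ + X]mxE => ->.
  by rewrite scaler_DI eqxx !mxE subrr.
have VD : DI K I \in V.
  have /memv_imgP [M VM] := GI; rewrite lfunE /= => gM.
  have sM : strictly_upper (M - 1 *: DI K I) by apply: g_su; rewrite ?scale1r //; apply: uV.
  have -> : DI K I = M - (M - 1 *: DI K I) by rewrite scale1r opprB addrC subrK.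
  exact: rpredB VM (NV _ sM).
exists I; split=> // A; split=> [VA | [c [N [suN ->]]]].
  have [c gA] : exists c, g A = c *: ind I.
    by apply: lineG; apply/memv_imgP; exists A; rewrite ?lfunE.
  exists c, (A - c *: DI K I); split; last by rewrite addrC subrK.
  by apply: g_su => //; apply: uV.
exact: rpredD (rpredZ _ VD) (NV _ suN).
Qed.

End Spectrum.

Lemma rVspace_basis (K : fieldType) m (U : {vspace 'rV[K]_m}) :
  exists2 A : 'M[K]_(\dim U, m), row_free A &
    forall x, (x \in U) = (x <= A)%MS.
Proof.
pose A := \matrix_(i < \dim U) (vbasis U)`_i; exists A.
  apply: inj_row_free => v; rewrite mulmx_sum_row.
  under eq_bigr => i _ do rewrite rowK.
  have /freeP free_U := basis_free (vbasisP U).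
  by move=> /free_U v0; apply/rowP=> i; rewrite v0 mxE.
move=> x; apply/idP/submxP => [/coord_vbasis Ux | [c ->]].
  exists (\row_i coord (vbasis U) i x); rewrite {1}Ux mulmx_sum_row.
  by apply: eq_bigr => i _; rewrite rowK mxE.
rewrite mulmx_sum_row rpred_sum // => i _; rewrite rowK rpredZ //.
by rewrite vbasis_mem // mem_nth // size_tuple.
Qed.

Lemma cVspace_basis (K : fieldType) m (U : {vspace 'cV[K]_m}) :
  exists2 A : 'M[K]_(\dim U, m), row_free A &
    forall x, (x \in U) = (x^T <= A)%MS.
Proof.
pose T := linfun (@trmx K m 1).
have dT : \dim (T @: U) = \dim U.
  apply: limg_dim_eq; apply/eqP; rewrite -subv0; apply/subvP=> x.
  rewrite memv_cap memv_ker lfunE /= memv0 => /andP [_ /eqP x0].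
  by rewrite -[x]trmxK x0 linear0.
have [A fA memA] := rVspace_basis (T @: U); rewrite dT in A fA memA.
exists A => // x; rewrite -memA; apply/idP/memv_imgP => [Ux | [y Uy]].
  by exists x; rewrite ?lfunE.
by rewrite lfunE => /trmx_inj ->.
Qed.

Lemma dimv_annihilator (K : fieldType) m (X : {vspace 'rV[K]_m})
    (D : {vspace 'cV[K]_m}) :
  (forall p d, p \in X -> d \in D -> p *m d = 0) ->
  (\dim X + \dim D <= m)%N /\
  (\dim X + \dim D = m -> forall p, (forall d, d \in D -> p *m d = 0) -> p \in X).
Proof.
move=> XD; have [A fA memX] := rVspace_basis X; have [B fB memD] := cVspace_basis D.
have AB (p : 'rV[K]_m) : (forall d, d \in D -> p *m d = 0) -> p *m B^T = 0.
  move=> pD; apply/rowP=> j; have := pD (row j B)^T.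
  rewrite memD trmxK row_sub tr_row colE mulmxA -colE => /(_ isT) /colP/(_ 0).
  by rewrite [LHS]mxE [RHS]mxE => ->; rewrite mxE.
have {}XD : A *m B^T = 0.
  apply/row_matrixP=> i; rewrite row_mul row0; apply: AB => d Dd.
  by apply: XD Dd; rewrite memX row_sub.
have rA := eqP fA; have rB := eqP fB.
have := mulmx0_rank_max XD; rewrite mxrank_tr rA rB; split=> // eqm p /AB pB.
have sAk : (A <= kermx B^T)%MS by apply/sub_kermxP.
rewrite memX.
have rk : \rank (kermx B^T) = \rank A.
  by rewrite mxrank_ker mxrank_tr rA rB; lia.
apply: submx_trans (_ : kermx B^T <= A)%MS; first exact/sub_kermxP.
by rewrite -(mxrank_leqif_sup sAk) rk.
Qed.

Lemma cVspace_double_annihilator (K : fieldType) m (D : {vspace 'cV[K]_m}) x :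
  (forall p : 'rV[K]_m, (forall d, d \in D -> p *m d = 0) -> p *m x = 0) ->
  x \in D.
Proof.
have [B _ memD] := cVspace_basis D; move=> Hx.
rewrite memD submxE; apply/eqP/rowP=> j.
have := Hx (col j (cokermx B))^T; rewrite -[(_^T *m x)]trmxK trmx_mul trmxK => e.
have /e : forall d, d \in D -> (col j (cokermx B))^T *m d = 0.
  move=> d; rewrite memD submxE => /eqP dB.
  by apply: trmx_inj; rewrite trmx_mul trmxK colE mulmxA dB mul0mx !linear0.
move=> /(congr1 trmx); rewrite trmxK colE mulmxA -colE linear0 => /colP/(_ 0).
by rewrite !mxE.
Qed.

Section Spaces.

Variables (K : fieldType) (L : closedFieldType) (f : {rmorphism K -> L}).
Hypotheses (nz2 : 2%:R != 0 :> K).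

Notation one_eigen := (one_eigen f).
Notation nil_eigen := (nil_eigen f).
Notation one_eigen_space := (one_eigen_space f).

Definition triangularizable n (V : {vspace 'M[K]_n}) : Prop :=
  exists P : 'M[K]_n, P \in unitmx /\ forall M, M \in V -> upper (conjm P M).

Definition dim_bound_at n : Prop := forall V : {vspace 'M[K]_n},
  one_eigen_space V -> (\dim V <= 'C(n, 2).+1)%N /\
  (\dim V = 'C(n, 2).+1 -> triangularizable V).

Lemma triangularizable_conjv n (P : 'M[K]_n) V : P \in unitmx ->
  triangularizable (conjv P V) -> triangularizable V.
Proof.
move=> uP [R [uR tR]]; exists (R *m P); split; first by rewrite unitmx_mul uR.
by move=> M VM; rewrite -conjm_comp //; apply/tR/conjm_conjv.
Qed.

Lemma max_space n (V : {vspace 'M[K]_n}) : one_eigen_space V ->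
  \dim V = 'C(n, 2).+1 -> triangularizable V ->
  exists P (I : {set 'I_n}), [/\ P \in unitmx, I != set0 &
    forall A, A \in V <-> inV1star I (conjm P A)].
Proof.
move=> QV dV [P [uP tP]]; have QW := one_eigen_conjv uP QV.
have [||I [nI memI]] := max_upper_space nz2 QW.
- by move=> M; rewrite memv_conjv // => /tP; rewrite conjmVK.
- by rewrite dimv_conjv.
exists P, I; split=> // A; rewrite -memI.
by rewrite memv_conjv // conjmK.
Qed.

Lemma nil_one_eigen_addscalar n (M : 'M[K]_n) c : nil_eigen M ->
  one_eigen (M + c%:M).
Proof.
move=> nM a b _ _; rewrite (root_char_shift f M c a) (root_char_shift f M c b).
move=> /nM /eqP; rewrite subr_eq0.
by move=> /eqP -> /nM /eqP; rewrite subr_eq0 => /eqP ->.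
Qed.

Lemma nil_space n (V : {vspace 'M[K]_n}) : dim_bound_at n ->
  (forall M, M \in V -> nil_eigen M) ->
  (\dim V <= 'C(n, 2))%N /\
  (\dim V = 'C(n, 2) -> exists P, P \in unitmx /\
     forall A, A \in V <-> strictly_upper (conjm P A)).
Proof.
move=> Hn nV; case: n => [|n] in V Hn nV *.
  have dV : \dim V = 0%N.
    by apply/eqP; rewrite -leqn0 (leq_trans (dimvS (subvf V))) // dimvf /dim /=.
  rewrite dV; split=> // _; exists 1%:M; split=> [|A]; first exact: unitmx1.
  by rewrite [A]flatmx0 mem0v; split=> // _ [].
pose W := (V + <[1%:M]>)%VS.
have memW M : M \in W -> exists N c, N \in V /\ M = N + c%:M.
  move=> /memv_addP [N VN [_ /vlineP [c ->] ->]]; exists N, c; split=> //.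
  by rewrite scalemx1.
have QW : one_eigen_space W.
  by move=> M /memW [N [c [VN ->]]]; apply/nil_one_eigen_addscalar/nV.
have n1V : 1%:M \notin V.
  apply/negP=> /nV /(_ 1); rewrite char_poly_upper; last first.
    by move=> i j lt_ji; rewrite !mxE -val_eqE /= gtn_eqF.
  rewrite big_ord_recl rmorphM rootM /= mxE eqxx map_polyXsubC rmorph1.
  by rewrite root_XsubC eqxx => /(_ isT) /eqP; rewrite oner_eq0.
have dW : \dim W = (\dim V).+1.
  rewrite dimv_disjoint_sum ?dim_vline; last first.
    apply/eqP; rewrite -subv0; apply/subvP=> M; rewrite memv_cap memv0.
    move=> /andP [VM /vlineP [c e]]; rewrite e; have [->|nzc] := eqVneq c 0.
      by rewrite scale0r.
    by move: VM; rewrite e rpredZeq (negPf nzc) (negPf n1V).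
  rewrite (_ : 1%:M != 0 = true) ?addn1 //; apply/eqP=> e.
  by rewrite e mem0v in n1V.
have [leW eqW] := Hn _ QW; rewrite dW in leW eqW; split=> // eqd.
have [P [uP tP]] := eqW (congr1 succn eqd).
have suV M : M \in V -> strictly_upper (conjm P M).
  move=> VM; apply: (nil_eigen_upper (f := f)); last exact/nil_eigen_conjm/nV.
  by apply: tP; rewrite /W -[M]addr0 memv_add ?mem0v.
have suW M : M \in conjv P V -> strictly_upper M.
  by rewrite memv_conjv // => /suV; rewrite conjmVK.
have [_ eqP] := dimv_strictly_upper suW.
exists P; split=> // A; split=> [|suA]; first exact: suV.
have := eqP _ _ suA; rewrite dimv_conjv // => /(_ eqd).
by rewrite memv_conjv // conjmK.
Qed.

Lemma root_char_ublock n1 n2 (A : 'M[K]_n1) (B : 'M[K]_(n1, n2)) (D : 'M[K]_n2) a :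
  root (map_poly f (char_poly (block_mx A B 0 D))) a =
  root (map_poly f (char_poly A)) a || root (map_poly f (char_poly D)) a.
Proof. by rewrite char_poly_ublock rmorphM rootM. Qed.

Lemma one_eigen_ublock n1 n2 (A : 'M[K]_n1) (B : 'M[K]_(n1, n2)) (D : 'M[K]_n2) :
  one_eigen (block_mx A B 0 D) -> one_eigen A /\ one_eigen D.
Proof.
move=> qM; split=> a b nza nzb ra rb; apply: qM; rewrite ?root_char_ublock ?ra ?rb //.
all: by rewrite orbT.
Qed.

Lemma root_char_scalar1 (A : 'M[K]_1) a :
  root (map_poly f (char_poly A)) a = (a == f (A 0 0)).
Proof. by rewrite char_poly_scalar1 map_polyXsubC root_XsubC. Qed.

End Spaces.

Lemma ulsubmx_linear (K : fieldType) m1 m2 n1 n2 :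
  linear (@ulsubmx K m1 m2 n1 n2).
Proof. by move=> a A B; apply/matrixP=> i j; rewrite !mxE. Qed.

HB.instance Definition _ (K : fieldType) m1 m2 n1 n2 :=
  GRing.isLinear.Build K _ _ _ (@ulsubmx K m1 m2 n1 n2)
    (@ulsubmx_linear K m1 m2 n1 n2).

Lemma ursubmx_linear (K : fieldType) m1 m2 n1 n2 :
  linear (@ursubmx K m1 m2 n1 n2).
Proof. by move=> a A B; apply/matrixP=> i j; rewrite !mxE. Qed.

HB.instance Definition _ (K : fieldType) m1 m2 n1 n2 :=
  GRing.isLinear.Build K _ _ _ (@ursubmx K m1 m2 n1 n2)
    (@ursubmx_linear K m1 m2 n1 n2).

Lemma dlsubmx_linear (K : fieldType) m1 m2 n1 n2 :
  linear (@dlsubmx K m1 m2 n1 n2).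
Proof. by move=> a A B; apply/matrixP=> i j; rewrite !mxE. Qed.

HB.instance Definition _ (K : fieldType) m1 m2 n1 n2 :=
  GRing.isLinear.Build K _ _ _ (@dlsubmx K m1 m2 n1 n2)
    (@dlsubmx_linear K m1 m2 n1 n2).

Lemma drsubmx_linear (K : fieldType) m1 m2 n1 n2 :
  linear (@drsubmx K m1 m2 n1 n2).
Proof. by move=> a A B; apply/matrixP=> i j; rewrite !mxE. Qed.

HB.instance Definition _ (K : fieldType) m1 m2 n1 n2 :=
  GRing.isLinear.Build K _ _ _ (@drsubmx K m1 m2 n1 n2)
    (@drsubmx_linear K m1 m2 n1 n2).

(** * The first column *)

Section FirstColumn.

Variables (K : fieldType) (L : closedFieldType) (f : {rmorphism K -> L}).
Hypotheses (nz2 : 2%:R != 0 :> K).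
Variables (m : nat) (V : {vspace 'M[K]_(1 + m)}).
Hypothesis QV : one_eigen_space f V.

Lemma mxtrace_topright (v : 'M[K]_(1 + m)) (p : 'rV[K]_m) :
  \tr (v *m block_mx 0 p 0 0) = (p *m dlsubmx v) 0 0.
Proof.
rewrite -{1}[v]submxK mulmx_block !mulmx0 !addr0 mxtrace_block linear0 add0r.
by rewrite mxtrace_mulC trace_mx11.
Qed.

Lemma topright_annihilates p v : block_mx 0 p 0 0 \in V -> v \in V ->
  p *m dlsubmx v = 0.
Proof.
move=> Vp Vv; apply/rowP=> j; rewrite ord1 -mxtrace_topright mxE.
apply: (one_eigen_trace2 nz2 QV) => //.
by rewrite mxtrace_block !linear0 addr0.
Qed.

Lemma one_eigen_corner (A : 'M[K]_m) :
  (forall t : K, exists l, block_mx t%:M l 0 A \in V) -> nil_eigen f A.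
Proof.
move=> HV a ra; apply/eqP; apply/negPn/negP=> nza.
have ea c : c != 0 -> a = f c.
  move=> nzc; have [l /QV] := HV c; apply; rewrite ?fmorph_eq0 // root_char_ublock.
    by rewrite ra orbT.
  by rewrite root_char_scalar1 mxE eqxx mulr1n eqxx.
have := ea 1 (oner_neq0 _); rewrite (ea (- 1)) ?oppr_eq0 ?oner_neq0 //.
by move=> /fmorph_inj /esym/eqP; rewrite (negPf (one_neq_opp nz2)).
Qed.

Lemma one_eigen_corner0 (a b : K) (A N : 'M[K]_m) l l' :
  block_mx a%:M l 0 A \in V -> block_mx b%:M l' 0 N \in V ->
  (forall t, root (map_poly f (char_poly (A + t *: N))) 1) -> b = 0.
Proof.
move=> VA VN rA; apply/eqP; apply/negPn/negP=> nzb.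
have val t : a + t * b = 0 \/ a + t * b = 1.
  have [-> | nz] := eqVneq (a + t * b) 0; [by left | right].
  have /QV := rpredD VA (rpredZ t VN).
  rewrite scale_block_mx add_block_mx scaler0 addr0 => H.
  apply: (fmorph_inj f); rewrite rmorph1; apply: H.
  - by rewrite fmorph_eq0.
  - exact: oner_neq0.
  - by rewrite root_char_ublock root_char_scalar1 !mxE eqxx !mulr1n eqxx.
  - by rewrite root_char_ublock rA orbT.
have := val 0; rewrite mul0r addr0 => v0; have := val 1; have := val (- 1).
rewrite mul1r mulN1r; case: v0 => ->.
  rewrite !add0r; case=> [/eqP | nb1]; first by rewrite oppr_eq0 (negPf nzb).
  case=> [/eqP | b1]; first by rewrite (negPf nzb).
  by move: (one_neq_opp nz2); rewrite -{1}nb1 -b1 eqxx.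
case=> [/eqP | /eqP]; last by rewrite -subr_eq0 addrAC subrr add0r oppr_eq0 (negPf nzb).
rewrite subr_eq0 => /eqP <-; case=> [/eqP | /eqP]; first by rewrite (negPf nz2).
by rewrite -subr_eq0 addrK oner_eq0.
Qed.

Lemma first_column_count (v s d a r r0 b x k c c' : nat) :
  (s + d = v -> r + a = s -> r0 + b = r -> x = r0 -> x + d <= k ->
  a + b <= c.+1 -> c' = c + k ->
  v <= c'.+1 /\ (v = c'.+1 -> x + d = k /\ a + b = c.+1))%N.
Proof. lia. Qed.

(* The dichotomy in the proof: either V contains some [q *; 0 0] with q <> 0, and
   then the lower right blocks of the matrices with first column in <e_0> are all
   nilpotent, or those blocks determine the matrix up to its top right part. *)
Lemma first_column_analysis : dim_bound_at f m ->
  (\dim V <= 'C(m.+1, 2).+1)%N /\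
  (\dim V = 'C(m.+1, 2).+1 ->
    (forall p : 'rV[K]_m, (forall v, v \in V -> p *m dlsubmx v = 0) ->
       block_mx 0 p 0 0 \in V) /\
    exists P : 'M[K]_m, P \in unitmx /\ forall N, strictly_upper N ->
      exists l, block_mx 0 l 0 (conjm (invmx P) N) \in V).
Proof.
move=> Hm.
pose Gdl := linfun (@dlsubmx K 1 m 1 m); pose Gdr := linfun (@drsubmx K 1 m 1 m).
pose Gul := linfun (@ulsubmx K 1 m 1 m); pose Gur := linfun (@ursubmx K 1 m 1 m).
pose D := (Gdl @: V)%VS; pose S := (V :&: lker Gdl)%VS.
pose A := (Gdr @: S)%VS; pose R := (S :&: lker Gdr)%VS.
pose B := (Gul @: R)%VS; pose R0 := (R :&: lker Gul)%VS.
pose X := (Gur @: R0)%VS.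
have memS v : v \in S -> exists u l, v = block_mx u%:M l 0 (drsubmx v) /\ v \in V.
  rewrite memv_cap memv_ker lfunE => /andP [Vv /eqP e].
  by exists (ulsubmx v 0 0), (ursubmx v); rewrite -mx11_scalar -{1}[v]submxK e.
have memR v : v \in R -> exists u l, v = block_mx u%:M l 0 0 /\ v \in V.
  rewrite memv_cap memv_ker lfunE => /andP [/memS [u [l [e Vv]]] /eqP e'].
  by exists u, l; split=> //; rewrite {1}e [drsubmx v]e'.
have memR0 v : v \in R0 -> exists p, v = block_mx 0 p 0 0 /\ v \in V.
  rewrite memv_cap memv_ker lfunE => /andP [/memR [u [l [e Vv]]] /eqP e'].
  by exists l; split=> //; rewrite e; move: e'; rewrite e /= block_mxKul => ->.
have dX : \dim X = \dim R0.
  apply: limg_dim_eq; apply/eqP; rewrite -subv0; apply/subvP=> v.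
  rewrite memv_cap memv_ker lfunE memv0 => /andP [/memR0 [p [e _]] /eqP e'].
  by move: e'; rewrite e /= block_mxKur => ->; rewrite block_mx0.
have memX p : p \in X -> block_mx 0 p 0 0 \in V.
  move=> /memv_imgP [v /memR0 [q [e Vv]]]; rewrite lfunE => ->.
  by rewrite e /= block_mxKur -e.
have [leXD eqXD] : (\dim X + \dim D <= m)%N /\ (\dim X + \dim D = m ->
    forall p : 'rV_m, (forall d, d \in D -> p *m d = 0) -> p \in X).
  apply: dimv_annihilator => p d /memX Vp /memv_imgP [v Vv ->].
  by rewrite lfunE; apply: topright_annihilates.
have E1 : \dim X + \dim D = m -> forall p : 'rV[K]_m,
    (forall v, v \in V -> p *m dlsubmx v = 0) -> block_mx 0 p 0 0 \in V.
  move=> e p Hp; apply/memX/(eqXD e) => d /memv_imgP [v Vv ->].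
  by rewrite lfunE; apply: Hp.
have memA a : a \in A -> exists u l, block_mx u%:M l 0 a \in V.
  move=> /memv_imgP [s /memS [u [l [e Vs]]]]; rewrite lfunE => ->.
  by exists u, l; rewrite -e.
have dV := limg_ker_dim Gdl V; rewrite -/S -/D in dV.
have dS := limg_ker_dim Gdr S; rewrite -/A -/R in dS.
have dR := limg_ker_dim Gul R; rewrite -/B -/R0 in dR.
have binm : 'C(m.+1, 2) = ('C(m, 2) + m)%N by rewrite binS bin1.
have dB : (\dim B <= 1)%N by rewrite (leq_trans (dimvS (subvf B))) // dimvf /dim.
have count := first_column_count dV dS dR dX leXD _ binm.
have [B0 | nzB] := eqVneq B 0%VS.
  have QA : one_eigen_space f A.
    by move=> a /memA [u [l /QV /one_eigen_ublock []]].
  have [leA eqA] := Hm A QA; rewrite B0 dimv0 !addn0 in count.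
  have [leV eqV] := count leA; split=> // /eqV [eXD dA].
  split; first exact: E1.
  have [P [I [uP nI memI]]] := max_space nz2 QA dA (eqA dA).
  have /set0Pn [i Ii] := nI.
  exists P; split=> // N suN.
  have memPA (c : K) M : strictly_upper M -> conjm (invmx P) (c *: DI K I + M) \in A.
    by move=> suM; apply/memI; rewrite conjmVK //; exists c, M.
  have AN : conjm (invmx P) N \in A by have := memPA 0 N suN; rewrite scale0r add0r.
  have [u [l VN]] := memA _ AN.
  have su0 : strictly_upper (0 : 'M[K]_m) by move=> *; rewrite mxE.
  have [u' [l' VD]] := memA _ (memPA 1 0 su0).
  exists l; suff u0 : u = 0 by move: VN; rewrite u0 raddf0.
  apply: (one_eigen_corner0 VD VN) => t.
  rewrite addr0 scale1r -linearZ -linearD /= char_poly_conjm ?unitmx_inv //.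
  have -> : 1 = f ((DI K I + t *: N) i i).
    by rewrite -[DI K I]scale1r mxE scaler_DI eqxx Ii mxE suN // mulr0 addr0 mulr1 rmorph1.
  apply: root_char_upper => j k lt_kj; rewrite -[DI K I]scale1r mxE scaler_DI mxE suN 1?ltnW //.
  by rewrite -val_eqE /= gtn_eqF // !mulr0 addr0.
have [q [q' [nzq VR]]] : exists q l, q != 0 /\ block_mx q%:M l 0 0 \in V.
  have := memv_pick B; have := nzB; rewrite -vpick0 => nzb /memv_imgP [r].
  move=> /memR [q [l [e Vr]]]; rewrite lfunE /= e block_mxKul => eb.
  by exists q, l; rewrite -e; split=> //; apply: contra nzb => /eqP q0; rewrite eb q0 raddf0.
have corner u t a l : block_mx u%:M l 0 a \in V -> exists l', block_mx t%:M l' 0 a \in V.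
  move=> Va; exists (l + ((t - u) / q) *: q').
  have := rpredD Va (rpredZ ((t - u) / q) VR).
  rewrite scale_block_mx add_block_mx !scaler0 !addr0 scale_scalar_mx -raddfD /=.
  by rewrite divfK // addrC subrK.
have nA a : a \in A -> nil_eigen f a.
  by move=> /memA [u [l Va]]; apply: one_eigen_corner => // t; apply: corner Va.
have [leA eqA] := nil_space Hm nA.
have [leV eqV] := count (etrans (congr1 (leq _) (esym (addn1 _))) (leq_add leA dB)).
split=> // /eqV [eXD dAB]; split; first exact: E1.
have dA : \dim A = 'C(m, 2).
  have arith (a b c : nat) : (a + b = c.+1 -> b <= 1 -> a <= c -> a = c)%N by lia.
  exact: arith dAB dB leA.
have [P [uP memP]] := eqA dA.
exists P; split=> // N suN.
have /memA [u [l Va]] : conjm (invmx P) N \in A by apply/memP; rewrite conjmVK.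
by have [l' Va'] := corner _ 0 _ _ Va; exists l'; rewrite raddf0 in Va'.
Qed.

End FirstColumn.

Lemma dlsubmx_mul (K : fieldType) m1 m2 (A B : 'M[K]_(m1 + m2)) :
  dlsubmx (A *m B) = dlsubmx A *m ulsubmx B + drsubmx A *m dlsubmx B.
Proof. by rewrite -{1}[A]submxK -{1}[B]submxK mulmx_block block_mxKdl. Qed.

Lemma drsubmx_mul (K : fieldType) m1 m2 (A B : 'M[K]_(m1 + m2)) :
  drsubmx (A *m B) = dlsubmx A *m ursubmx B + drsubmx A *m drsubmx B.
Proof. by rewrite -{1}[A]submxK -{1}[B]submxK mulmx_block block_mxKdr. Qed.

Lemma strictly_upper_delta (K : fieldType) m (i j : 'I_m) : (i < j)%N ->
  strictly_upper (delta_mx i j : 'M[K]_m).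
Proof.
move=> lt_ij a b le_ba; rewrite mxE; case: andP => // -[/eqP ea /eqP eb].
by rewrite -ea -eb ltnNge le_ba in lt_ij.
Qed.

Section StableFlag.

Variables (K : fieldType) (L : closedFieldType) (f : {rmorphism K -> L}).
Hypotheses (nz2 : 2%:R != 0 :> K) (nz3 : 3%:R != 0 :> K).
Variables (m : nat) (V : {vspace 'M[K]_(1 + m)}).
Hypothesis QV : one_eigen_space f V.
Hypothesis annV : forall p : 'rV[K]_m,
  (forall v, v \in V -> p *m dlsubmx v = 0) -> block_mx 0 p 0 0 \in V.
Hypothesis liftV : forall N : 'M[K]_m, strictly_upper N ->
  exists l, block_mx 0 l 0 N \in V.

Let X (p : 'rV[K]_m) := block_mx (0 : 'M_1) p (0 : 'cV_m) (0 : 'M_m) \in V.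

Let annX p v : X p -> v \in V -> p *m dlsubmx v = 0.
Proof. exact: (topright_annihilates nz2 QV). Qed.

Let trX (p : 'rV[K]_m) : \tr (block_mx (0 : 'M_1) p (0 : 'cV_m) (0 : 'M_m)) = 0.
Proof. by rewrite mxtrace_block !linear0 addr0. Qed.

Let tr_dl (p : 'rV[K]_m) (M : 'M[K]_(1 + m)) : \tr (M *m block_mx 0 p 0 0) = 0 ->
  p *m dlsubmx M = 0.
Proof.
by move=> e; apply/rowP=> j; rewrite ord1 -mxtrace_topright mxE.
Qed.

Lemma flag_quadratic p u v : X p -> u \in V -> v \in V ->
  p *m (drsubmx u *m dlsubmx v + drsubmx v *m dlsubmx u) = 0.
Proof.
move=> Xp Vu Vv.
have := tr_dl (one_eigen_trace3_polar nz2 nz3 QV Vu Vv Xp (trX p)).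
rewrite linearD /= !dlsubmx_mul !mulmxDr !(mulmxA p).
by rewrite (annX Xp Vu) (annX Xp Vv) !mul0mx !add0r.
Qed.

Lemma flag_stable p (N : 'M[K]_m) : strictly_upper N -> X p -> X (p *m N).
Proof.
move=> /liftV [l Vz] Xp; apply: annV => v Vv.
have := flag_quadratic Xp Vz Vv.
by rewrite block_mxKdl block_mxKdr mulmx0 addr0 mulmxA.
Qed.

Lemma flag_cubic p (N : 'M[K]_m) u v : strictly_upper N -> X p ->
  u \in V -> v \in V ->
  p *m (drsubmx u *m N *m dlsubmx v + drsubmx v *m N *m dlsubmx u) = 0.
Proof.
move=> suN Xp Vu Vv; have XpN := flag_stable suN Xp; have [l Vz] := liftV suN.
have := tr_dl (one_eigen_trace4_polar nz2 nz3 QV Vu Vv Vz Xp (trX p)).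
have e := flag_quadratic XpN Vu Vv; have eu := annX XpN Vu; have ev := annX XpN Vv.
have eu' := annX Xp Vu; have ev' := annX Xp Vv.
rewrite !linearD /= !(dlsubmx_mul, drsubmx_mul).
rewrite block_mxKul block_mxKur block_mxKdl block_mxKdr.
rewrite !(mulmx0, mul0mx, addr0, add0r) !(mulmxDr, mulmxDl) !mulmxA.
rewrite eu ev eu' ev' !(mul0mx, add0r) => e0; rewrite -[RHS]e0.
move: e; rewrite mulmxDr !mulmxA => e1.
have drop (a b c d : 'M[K]_1) : c + d = 0 -> a + b + c + d = a + b.
  by move=> cd; rewrite -addrA cd addr0.
by rewrite drop // -[RHS]e1.
Qed.

Lemma column_height : exists r, [/\ (r <= m)%N,
    forall v (i : 'I_m), v \in V -> (r <= i)%N -> dlsubmx v i 0 = 0 &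
    (0 < r)%N -> exists2 v, v \in V & exists2 k : 'I_m, k.+1 = r & dlsubmx v k 0 != 0].
Proof.
pose low r (v : 'M[K]_(1 + m)) := [forall i : 'I_m, (r <= i)%N ==> (dlsubmx v i 0 == 0)].
have lowV r : all (low r) (vbasis V) -> forall v (i : 'I_m),
    v \in V -> (r <= i)%N -> dlsubmx v i 0 = 0.
  move=> /allP lowB v i /coord_vbasis -> le_ri; rewrite linear_sum summxE big1 // => j _.
  rewrite linearZ /= mxE; apply/eqP; rewrite mulf_eq0; apply/orP; right.
  have /lowB/forallP/(_ i) : (vbasis V)`_j \in vbasis V by rewrite mem_nth ?size_tuple.
  by rewrite le_ri.
have exr : exists r, all (low r) (vbasis V).
  by exists m; apply/allP => v _; apply/forallP=> i; rewrite leqNgt ltn_ord.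
case: (ex_minnP exr) => r lowr minr; exists r; split; [|exact: lowV|].
  by apply: minr; apply/allP => v _; apply/forallP=> i; rewrite leqNgt ltn_ord.
case: r lowr minr => // r lowr minr _.
have /allPn [v Bv] : ~~ all (low r) (vbasis V).
  by apply/negP=> /minr; rewrite ltnn.
rewrite negb_forall => /existsP [i]; rewrite negb_imply => /andP [le_ri nz].
have Vv : v \in V by apply: vbasis_mem.
exists v => //; exists i => //; apply/eqP; rewrite eqSS eqn_leq le_ri andbT leqNgt.
by apply/negP=> lt_ri; rewrite (lowV _ lowr) // eqxx in nz.
Qed.

Lemma column_saturated x : (forall p, X p -> p *m x = 0) ->
  exists2 v, v \in V & x = dlsubmx v.
Proof.
move=> Hx; pose D := (linfun (@dlsubmx K 1 m 1 m) @: V)%VS.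
have /memv_imgP [v Vv ->] : x \in D.
  apply: cVspace_double_annihilator => p pD; apply/Hx/annV => v Vv.
  by apply: pD; apply/memv_imgP; exists v; rewrite ?lfunE.
by exists v; rewrite // lfunE.
Qed.

(* With x = dl v0 having its last nonzero entry at k, taking N = E_(j,k) in the cubic
   identity kills (p dr u)_j for j < k; the quadratic one then handles j = k. *)
Lemma stable_flag p0 : p0 != 0 -> X p0 ->
  exists2 r, (r < m)%N & forall M, M \in V ->
    forall i j : 'I_(1 + m), (j <= r)%N -> (r < i)%N -> M i j = 0.
Proof.
move=> nzp0 Xp0; have [r [le_rm lowV topV]] := column_height.
have [r0 | r_gt0] := posnP r.
  exists 0%N.
    rewrite lt0n; apply: contraNneq nzp0 => m0.
    by apply/eqP/rowP=> j; have := ltn_ord j; rewrite [X in (_ < X)%N]m0.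
  move=> M VM i j; rewrite leqn0 => /eqP j0 i_gt0.
  have -> : j = lshift m 0 by apply: val_inj.
  case: (split_ordP i) i_gt0 => k ->; first by rewrite ord1.
  have := lowV M k VM; rewrite r0 /= => /(_ isT).
  by rewrite !mxE.
have [v0 Vv0 [k def_r nzk]] := topV r_gt0; set x := dlsubmx v0 in nzk.
have x0 (i : 'I_m) : (k < i)%N -> x i 0 = 0 by move=> lt_ki; apply: lowV; rewrite -?def_r.
have cs (A : 'rV[K]_m) (y : 'cV[K]_m) : (A *m y) 0 0 = \sum_j A 0 j * y j 0 by rewrite mxE.
have deltaE (A : 'rV[K]_m) (j : 'I_m) (y : 'cV[K]_m) :
    (A *m delta_mx j k *m y) 0 0 = A 0 j * y k 0.
  rewrite -mulmxA cs (bigD1 j) //= big1 ?addr0.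
    rewrite !mxE (bigD1 k) //= big1 ?addr0 ?mxE ?eqxx ?mul1r // => i nik.
    by rewrite mxE (negPf nik) andbF mul0r.
  move=> i nij; rewrite mxE big1 ?mulr0 // => l _.
  by rewrite mxE (negPf nij) mul0r.
have half c : c + c = 0 -> c = 0 :> K.
  by move=> /eqP; rewrite -mulr2n -mulr_natl mulf_eq0 (negPf nz2) => /eqP.
have low_k (p : 'rV[K]_m) (M : 'M[K]_m) :
   (forall j : 'I_m, (j < k)%N -> (p *m M) 0 j = 0) -> forall y : 'cV[K]_m,
   (forall i : 'I_m, (k < i)%N -> y i 0 = 0) ->
   (p *m (M *m y)) 0 0 = (p *m M) 0 k * y k 0.
  move=> pM y yk; rewrite mulmxA cs (bigD1 k) //= big1 ?addr0 // => i nik.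
  have [lt_ik | le_ki] := ltnP i k; first by rewrite pM ?mul0r.
  by rewrite yk ?mulr0 // ltn_neqAle eq_sym le_ki andbT.
have dlk u : u \in V -> forall i : 'I_m, (k < i)%N -> dlsubmx u i 0 = 0.
  by move=> Vu i lt_ki; apply: lowV; rewrite -?def_r.
have beta p u (j : 'I_m) : X p -> u \in V -> (j <= k)%N -> (p *m drsubmx u) 0 j = 0.
  have cubic q w (i : 'I_m) : X q -> w \in V -> (i < k)%N ->
      (q *m drsubmx w) 0 i * x k 0 + (q *m drsubmx v0) 0 i * dlsubmx w k 0 = 0.
    move=> Xq Vw lt_ik.
    have := flag_cubic (strictly_upper_delta K lt_ik) Xq Vw Vv0.
    move=> /rowP/(_ 0); rewrite mulmxDr !mulmxA mxE !deltaE => ->.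
    by rewrite mxE.
  have cubic0 q w (i : 'I_m) : X q -> w \in V -> (i < k)%N -> (q *m drsubmx w) 0 i = 0.
    move=> Xq Vw lt_ik; have /eqP := half _ (cubic q v0 i Xq Vv0 lt_ik).
    rewrite mulf_eq0 (negPf nzk) orbF => /eqP e0.
    have /eqP := cubic q w i Xq Vw lt_ik.
    by rewrite e0 mul0r addr0 mulf_eq0 (negPf nzk) orbF => /eqP.
  have quad q w : X q -> w \in V ->
      (q *m drsubmx w) 0 k * x k 0 + (q *m drsubmx v0) 0 k * dlsubmx w k 0 = 0.
    move=> Xq Vw; have := flag_quadratic Xq Vw Vv0.
    move=> /rowP/(_ 0); rewrite mulmxDr mxE.
    rewrite (low_k _ _ (fun i => cubic0 q w i Xq Vw) _ x0).
    rewrite (low_k _ _ (fun i => cubic0 q v0 i Xq Vv0) _ (dlk w Vw)) => ->.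
    by rewrite mxE.
  move=> Xp Vu; rewrite leq_eqVlt => /predU1P [/val_inj -> | lt_jk]; last exact: cubic0.
  have /eqP := half _ (quad p v0 Xp Vv0).
  rewrite mulf_eq0 (negPf nzk) orbF => /eqP e0.
  have /eqP := quad p u Xp Vu.
  by rewrite e0 mul0r addr0 mulf_eq0 (negPf nzk) orbF => /eqP.
have drV u (i j : 'I_m) : u \in V -> (j <= k)%N -> (k < i)%N -> drsubmx u i j = 0.
  move=> Vu le_jk lt_ki; have [p Xp | v Vv e] := column_saturated (x := col j (drsubmx u)).
    apply/rowP=> l; rewrite ord1 colE mulmxA -colE mxE (beta p u j Xp Vu le_jk).
    by rewrite mxE.
  by have := dlk _ Vv i lt_ki; rewrite -e mxE.
have lt_rm : (r < m)%N.
  rewrite ltn_neqAle le_rm andbT; apply: contraNneq nzp0 => eq_rm.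
  have max_k (i : 'I_m) : (i <= k)%N by rewrite -ltnS def_r eq_rm.
  have p0x := annX Xp0 Vv0; have p0j (j : 'I_m) : (j < k)%N -> p0 0 j = 0.
    move=> lt_jk; have XN := flag_stable (strictly_upper_delta K lt_jk) Xp0.
    have := annX XN Vv0; move=> /rowP/(_ 0); rewrite deltaE [RHS]mxE => /eqP.
    by rewrite mulf_eq0 (negPf nzk) orbF => /eqP.
  have /eqP : p0 0 k * x k 0 = 0.
    have <- : (p0 *m x) 0 0 = 0 by rewrite p0x mxE.
    rewrite cs (bigD1 k) //= big1 ?addr0 // => i nik.
    by rewrite p0j ?mul0r // ltn_neqAle max_k andbT.
  rewrite mulf_eq0 (negPf nzk) orbF => /eqP p0k; apply/eqP/rowP=> j; rewrite [RHS]mxE.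
  have := max_k j; rewrite leq_eqVlt => /predU1P [/val_inj -> // | ]; exact: p0j.
exists r => // M VM i j.
case: (split_ordP i) => i' ->; rewrite /= ?ord1 //.
move=> le_jr lt_ri; have lt_ki : (k < i')%N by rewrite -ltnS def_r.
case: (split_ordP j) le_jr => j' -> /=.
  by move=> _; have := dlk M VM i' lt_ki; rewrite !mxE ord1.
move=> lt_jr; have le_jk : (j' <= k)%N by rewrite -ltnS def_r.
by have := drV M i' j' VM le_jk lt_ki; rewrite !mxE.
Qed.

End StableFlag.

(** * Block triangular spaces *)

Lemma bin2D p q : 'C(p + q, 2) = ('C(p, 2) + 'C(q, 2) + p * q)%N.
Proof.
elim: p => [|p IH]; first by rewrite bin0n mul0n addn0.
by rewrite addSn !(binS _ 1) !bin1 IH; lia.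
Qed.

Section BlockSpaces.

Variables (K : fieldType) (L : closedFieldType) (f : {rmorphism K -> L}).
Hypotheses (nz2 : 2%:R != 0 :> K).

Definition one_eigen_pair p q (x : 'M[K]_p * 'M[K]_q) : Prop :=
  forall a b : L, a != 0 -> b != 0 ->
    root (map_poly f (char_poly x.1)) a || root (map_poly f (char_poly x.2)) a ->
    root (map_poly f (char_poly x.1)) b || root (map_poly f (char_poly x.2)) b ->
    a = b.

(* Only the first components are triangularized: the statement for the second ones
   follows by exchanging the factors. *)
Lemma pair_space_triangularizable p q (W : {vspace 'M[K]_p * 'M[K]_q}) :
  (forall x, x \in W -> one_eigen_pair x) ->
  dim_bound_at f p -> dim_bound_at f q ->
  ('C(p, 2) + 'C(q, 2) < \dim W)%N ->
  exists P, P \in unitmx /\ forall x, x \in W -> upper (conjm P x.1).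
Proof.
move=> QW Hp Hq dW.
pose F1 := linfun (@fst 'M[K]_p 'M[K]_q); pose F2 := linfun (@snd 'M[K]_p 'M[K]_q).
pose W1 := (F1 @: W)%VS; pose W2 := (F2 @: W)%VS; pose Z := (W :&: lker F1)%VS.
pose W2' := (F2 @: Z)%VS.
have memW1 M : M \in W1 -> exists N, (M, N) \in W.
  by move=> /memv_imgP [[A B] WAB ->]; rewrite lfunE; exists B.
have memW2 N : N \in W2 -> exists M, (M, N) \in W.
  by move=> /memv_imgP [[A B] WAB ->]; rewrite lfunE; exists A.
have memZ x : x \in Z -> x = (0, x.2) /\ x \in W.
  rewrite memv_cap memv_ker lfunE; case: x => A B /andP [WAB /eqP /= A0].
  by rewrite -A0.
have memW2' N : N \in W2' -> (0, N) \in W.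
  by move=> /memv_imgP [x /memZ [e Wx] ->]; rewrite lfunE /= -e.
have dZ : \dim W2' = \dim Z.
  apply: limg_dim_eq; apply/eqP; rewrite -subv0; apply/subvP=> x.
  rewrite memv_cap memv_ker lfunE memv0 => /andP [/memZ [-> _] /eqP /= ->].
  exact: eqxx.
have Q1 : one_eigen_space f W1.
  by move=> M /memW1 [N /QW qx] a b nza nzb ra rb; apply: qx => //=; rewrite ?ra ?rb.
have Q2 : one_eigen_space f W2.
  by move=> N /memW2 [M /QW qx] a b nza nzb ra rb; apply: qx => //=; rewrite ?ra ?rb orbT.
have s2 : (W2' <= W2)%VS by apply: limgS; apply: capvSl.
have Q2' : one_eigen_space f W2' by move=> N /(subvP s2); apply: Q2.
have [le1 eq1] := Hp _ Q1; have [le2 _] := Hq _ Q2; have [le2' eq2'] := Hq _ Q2'.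
have dV := limg_ker_dim F1 W; rewrite -/Z -dZ -/W1 in dV.
have arith (a b w c c' : nat) : (b + a = w -> c + c' < w -> a <= c.+1 -> b <= c'.+1 ->
    a = c.+1 \/ b = c'.+1 /\ c <= a)%N by lia.
case: (arith _ _ _ _ _ dV dW le1 le2') => [/eq1 [P [uP tP]] | [d2 ge1]].
  by exists P; split=> // -[A B] WAB; apply: tP; apply/memv_imgP; exists (A, B); rewrite ?lfunE.
have eqW2 : W2' = W2.
  by apply/eqP; rewrite eqEdim s2 d2.
have [P [I [uP nI memI]]] := max_space nz2 Q2' d2 (eq2' d2).
have /set0Pn [i Ii] := nI.
have nW1 M : M \in W1 -> nil_eigen f M.
  move=> /memW1 [N WMN] a ra; apply/eqP; apply/negPn/negP=> nza.
  have ea t : t != 0 -> a = f t.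
    move=> nzt; pose E := conjm (invmx P) (t *: DI K I).
    have W2E : E \in W2'.
      apply/memI; rewrite conjmVK //; exists t, 0; split; last by rewrite addr0.
      by move=> j k _; rewrite mxE.
    have W0N : (0, N) \in W.
      by apply: memW2'; rewrite eqW2; apply/memv_imgP; exists (M, N); rewrite ?lfunE.
    have WME : (M, E) \in W.
      have := rpredD (rpredB WMN W0N) (memW2' _ W2E).
      by congr (_ \in W); congr (_, _) => /=; rewrite ?subr0 ?addr0 // subrr add0r.
    apply: (QW _ WME) => //=; rewrite ?fmorph_eq0 ?ra //.
    rewrite char_poly_conjm ?unitmx_inv //.
    have -> : f t = f ((t *: DI K I) i i) by rewrite scaler_DI eqxx Ii mulr1.
    rewrite root_char_upper ?orbT // => j k lt_kj.
    by rewrite scaler_DI -val_eqE /= gtn_eqF // mulr0.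
  have := ea 1 (oner_neq0 _); rewrite (ea (- 1)) ?oppr_eq0 ?oner_neq0 //.
  by move=> /fmorph_inj /esym/eqP; rewrite (negPf (one_neq_opp nz2)).
have [leW1 eqW1] := nil_space Hp nW1.
have [|R [uR memR]] := eqW1; first by apply/eqP; rewrite eqn_leq leW1.
exists R; split=> // -[A B] WAB; have WA : A \in W1.
  by apply/memv_imgP; exists (A, B); rewrite ?lfunE.
by move/memR: WA => /strictly_upperP [].
Qed.

Lemma block_triangularizable n p q (e : n = (p + q)%N) (V : {vspace 'M[K]_n}) :
  (forall M, M \in V -> forall i j : 'I_n, (j < p)%N -> (p <= i)%N -> M i j = 0) ->
  one_eigen_space f V -> dim_bound_at f p -> dim_bound_at f q ->
  \dim V = 'C(n, 2).+1 -> triangularizable V.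
Proof.
subst n => V0 QV Hp Hq dV.
have blockV M : M \in V -> M = block_mx (ulsubmx M) (ursubmx M) 0 (drsubmx M).
  move=> VM; rewrite -[LHS]submxK; congr block_mx.
  by apply/matrixP=> i j; rewrite !mxE V0 //= leq_addr.
pose g (M : 'M[K]_(p + q)) := (ulsubmx M, drsubmx M).
have lin_g : linear g by move=> a A B; rewrite /g !linearP.
pose gl : {linear 'M[K]_(p + q) -> ('M[K]_p * 'M[K]_q)%type} :=
  HB.pack g (GRing.isLinear.Build K _ _ _ g lin_g).
pose G := linfun gl; pose W := (G @: V)%VS.
pose Z := (V :&: lker G)%VS; pose Y := (linfun (@ursubmx K p q p q) @: Z)%VS.
have dY : \dim Y = \dim Z.
  apply: limg_dim_eq; apply/eqP; rewrite -subv0; apply/subvP=> M.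
  rewrite !memv_cap !memv_ker !lfunE memv0 => /andP [/andP [VM /eqP [ul0 dr0]] /eqP /= ur0].
  by rewrite (blockV M VM) ul0 dr0 ur0 block_mx0.
have leY : (\dim Y <= p * q)%N by rewrite (leq_trans (dimvS (subvf Y))) // dimvf.
have dW := limg_ker_dim G V; rewrite -/Z -/W -dY dV bin2D in dW.
have arith (a b y w k : nat) : (y + w = (a + b + k).+1 -> y <= k -> a + b < w)%N by lia.
have ltW := arith _ _ _ _ _ dW leY.
have QW x : x \in W -> one_eigen_pair x.
  move=> /memv_imgP [M VM ->]; rewrite lfunE /= => a b nza nzb.
  have := QV M VM; rewrite {1}(blockV M VM) => qM ra rb.
  by apply: qM; rewrite ?root_char_ublock.
have [P [uP tP]] := pair_space_triangularizable QW Hp Hq ltW.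
pose swp (x : 'M[K]_p * 'M[K]_q) := (x.2, x.1).
have lin_s : linear swp by [].
pose sl : {linear ('M[K]_p * 'M[K]_q)%type -> ('M[K]_q * 'M[K]_p)%type} :=
  HB.pack swp (GRing.isLinear.Build K _ _ _ swp lin_s).
pose W' := (linfun sl @: W)%VS.
have dW' : \dim W' = \dim W.
  apply: limg_dim_eq; apply/eqP; rewrite -subv0; apply/subvP=> -[A B].
  by rewrite memv_cap memv_ker lfunE memv0 => /andP [_ /eqP [-> ->]].
have QW' x : x \in W' -> one_eigen_pair x.
  move=> /memv_imgP [[A B] /QW qAB ->]; rewrite lfunE /= => a b nza nzb /= ra rb.
  by apply: qAB => //=; rewrite orbC.
have [|R [uR tR]] := pair_space_triangularizable QW' Hq Hp.
  by rewrite dW' addnC.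
have PR1 : block_mx P 0 0 R *m block_mx (invmx P) 0 0 (invmx R) = 1%:M.
  by rewrite mulmx_block !(mulmx0, mul0mx, addr0, add0r) !mulmxV // -scalar_mx_block.
exists (block_mx P 0 0 R); split; first by have [] := mulmx1_unit PR1.
move=> M VM; rewrite /conjm (invmx_uniq PR1) (blockV M VM) !mulmx_block.
rewrite !(mulmx0, mul0mx, addr0, add0r).
have WM : (ulsubmx M, drsubmx M) \in W by apply/memv_imgP; exists M; rewrite ?lfunE.
have W'M : (drsubmx M, ulsubmx M) \in W'.
  by apply/memv_imgP; exists (ulsubmx M, drsubmx M); rewrite ?lfunE.
have u1 := tP _ WM; have u2 := tR _ W'M => i j.
case: (split_ordP i) => i' ->; case: (split_ordP j) => j' -> /= lt_ji.
- by rewrite block_mxEul; apply: u1.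
- by have := ltn_ord i'; lia.
- by rewrite block_mxEdl mxE.
- by rewrite block_mxEdr; apply: u2; rewrite ltn_add2l in lt_ji.
Qed.

End BlockSpaces.

(** * Rank one nilpotents *)

Section RankOne.

Variables (K : fieldType) (L : closedFieldType) (f : {rmorphism K -> L}).
Hypotheses (nz2 : 2%:R != 0 :> K) (nz3 : 3%:R != 0 :> K).
Variables (m : nat).
Hypothesis boundm : forall k, (k <= m)%N -> dim_bound_at f k.

Lemma flag_coordinates (V : {vspace 'M[K]_(1 + m)}) :
  one_eigen_space f V -> \dim V = 'C(m.+1, 2).+1 ->
  exists (R : 'M[K]_(1 + m)) (P : 'M[K]_m),
   [/\ R \in unitmx, P \in unitmx,
     forall p, conjm R (block_mx 0 p 0 0) = block_mx 0 (p *m P) 0 0,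
     forall p : 'rV[K]_m, (forall v, v \in conjv R V -> p *m dlsubmx v = 0) ->
       block_mx 0 p 0 0 \in conjv R V &
     forall N : 'M[K]_m, strictly_upper N ->
       exists l, block_mx 0 l 0 N \in conjv R V].
Proof.
move=> QV dV; have bm := boundm (leqnn m).
have [_ /(_ dV) [_ [P [uP liftP]]]] := first_column_analysis nz2 QV bm.
pose R := block_mx (1%:M : 'M[K]_1) 0 0 P.
have R1 : R *m block_mx (1%:M : 'M[K]_1) 0 0 (invmx P) = 1%:M.
  rewrite mulmx_block !(mulmx0, mul0mx, addr0, add0r) mulmx1 mulmxV //.
  by rewrite -scalar_mx_block.
have uR : R \in unitmx by have [] := mulmx1_unit R1.
have conjR p N : conjm R (block_mx 0 p 0 N) = block_mx 0 (p *m invmx P) 0 (conjm P N).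
  rewrite /conjm (invmx_uniq R1) !mulmx_block.
  by rewrite !(mulmx0, mul0mx, addr0, add0r) mul1mx.
have dW : \dim (conjv R V) = 'C(m.+1, 2).+1 by rewrite dimv_conjv.
have QW := one_eigen_conjv uR QV.
have [_ /(_ dW) [annW _]] := first_column_analysis nz2 QW bm.
exists R, (invmx P); split=> //; first by rewrite unitmx_inv.
  by move=> p; rewrite conjR linear0.
move=> N /liftP [l Vl]; exists (l *m invmx P).
by have := conjm_conjv R Vl; rewrite conjR conjmVK.
Qed.

Lemma topright_triangularizable (V : {vspace 'M[K]_(1 + m)}) (p : 'rV[K]_m) :
  one_eigen_space f V -> \dim V = 'C(m.+1, 2).+1 ->
  p != 0 -> block_mx 0 p 0 0 \in V -> triangularizable V.
Proof.
move=> QV dV nzp Vp; have [R [P [uR uP conjR annW liftW]]] := flag_coordinates QV dV.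
have nzpP : p *m P != 0.
  by apply: contra nzp => /eqP e; rewrite -[p](mulmxK uP) e mul0mx.
have WpP := conjm_conjv R Vp; rewrite conjR in WpP.
have QW := one_eigen_conjv uR QV.
have [r lt_rm Hr] := stable_flag nz2 nz3 QW annW liftW nzpP WpP.
apply: (triangularizable_conjv uR).
have e : (1 + m = r.+1 + (m - r))%N by lia.
apply: (block_triangularizable nz2 e _ QW).
- by move=> M WM i j lt_jr lt_ri; apply: Hr.
- exact: boundm.
- by apply: boundm; rewrite leq_subr.
- by rewrite dimv_conjv.
Qed.

Lemma rank_one_triangularizable (V : {vspace 'M[K]_(1 + m)})
    (x : 'cV[K]_(1 + m)) (p : 'rV[K]_(1 + m)) :
  one_eigen_space f V -> \dim V = 'C(m.+1, 2).+1 ->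
  x != 0 -> p != 0 -> p *m x = 0 -> x *m p \in V -> triangularizable V.
Proof.
move=> QV dV nzx nzp px Vxp; have [R uR Rx] := col_to_e0 nzx.
pose q := p *m invmx R.
have q0 : lsubmx q = 0.
  have -> : lsubmx q = q *m col_mx 1%:M 0.
    by rewrite -{2}[q]hsubmxK mul_row_col mulmx1 mulmx0 addr0.
  by rewrite -Rx /q mulmxA mulmxKV // px.
have defq : q = row_mx 0 (rsubmx q) by rewrite -{1}[q]hsubmxK q0.
have nzq : rsubmx q != 0.
  apply: contra nzp => /eqP e; rewrite -[p](mulmxKV uR) -/q defq e row_mx0.
  by rewrite mul0mx.
apply: (triangularizable_conjv uR); apply: topright_triangularizable nzq _.
- exact: one_eigen_conjv.
- by rewrite dimv_conjv.
have -> : block_mx 0 (rsubmx q) 0 0 = conjm R (x *m p).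
  rewrite /conjm mulmxA Rx -mulmxA -/q defq mul_col_row row_mxKr.
  by rewrite !mul1mx !mul0mx.
exact: conjm_conjv.
Qed.

End RankOne.

Section RankOneExistence.

Variables (K : fieldType) (L : closedFieldType) (f : {rmorphism K -> L}).
Hypotheses (nz2 : 2%:R != 0 :> K) (nz3 : 3%:R != 0 :> K).

Lemma rank_one_size2 (V : {vspace 'M[K]_(1 + 1)}) :
  one_eigen_space f V -> \dim V = 2 ->
  (forall p : 'rV[K]_1, block_mx 0 p 0 0 \in V -> p = 0) ->
  exists (x : 'cV[K]_(1 + 1)) (p : 'rV[K]_(1 + 1)),
    [/\ x != 0, p != 0, p *m x = 0 & x *m p \in V].
Proof.
move=> QV dV X0; pose g (M : 'M[K]_(1 + 1)) : 'rV[K]_1 := const_mx (\tr M).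
have lin_g : linear g.
  by move=> a A B; apply/rowP=> i; rewrite !mxE linearP.
pose gl : {linear 'M[K]_(1 + 1) -> 'rV[K]_1} :=
  HB.pack g (GRing.isLinear.Build K _ _ _ g lin_g).
have := limg_ker_dim (linfun gl) V; set Z := (V :&: _)%VS; rewrite dV => dZ.
have le1 : (\dim (linfun gl @: V) <= 1)%N.
  by rewrite (leq_trans (dimvS (subvf _))) // dimvf.
have nzZ : Z != 0%VS.
  by apply/eqP=> Z0; rewrite Z0 dimv0 add0n in dZ; rewrite dZ in le1.
have nzw := nzZ; rewrite -vpick0 in nzw.
have := memv_pick Z; set w := vpick Z in nzw *.
rewrite memv_cap memv_ker lfunE /= => /andP [Vw /eqP/rowP/(_ 0)]; rewrite !mxE => trw.
have trww := one_eigen_trace2 nz2 QV Vw Vw trw.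
have sp := @mx11_scalar K; move: trw trww nzw Vw.
rewrite -[w]submxK (sp (ulsubmx w)) (sp (ursubmx w)) (sp (dlsubmx w)) (sp (drsubmx w)).
move: (ulsubmx w 0 0) (ursubmx w 0 0) (dlsubmx w 0 0) (drsubmx w 0 0) => a b c d.
rewrite mulmx_block !mxtrace_block -!scalar_mxM -!raddfD /= !mxtrace_scalar.
rewrite !mulr1n => /eqP; rewrite addr_eq0 => /eqP -> trww nzw Vw.
have det0 : d ^+ 2 + b * c = 0.
  have /eqP : 2 * (d ^+ 2 + b * c) = 0 by rewrite -[RHS]trww; ring.
  by rewrite mulf_eq0 (negPf nz2) => /eqP.
have nzc : c != 0.
  apply: contra nzw => /eqP c0; move: det0 Vw; rewrite c0 mulr0 addr0 => /eqP.
  rewrite expf_eq0 /= => /eqP ->; rewrite oppr0 !raddf0 => /X0 ->.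
  by rewrite block_mx0.
exists (col_mx (- d)%:M c%:M), (row_mx 1%:M (d / c)%:M); split.
- apply: contra nzc; rewrite col_mx_eq0 => /andP [_ /eqP/matrixP/(_ 0 0)].
  by rewrite !mxE mulr1n => ->.
- rewrite row_mx_eq0; apply/nandP; left; apply/eqP=> /matrixP/(_ 0 0)/eqP.
  by rewrite !mxE mulr1n oner_eq0.
- rewrite mul_row_col -!scalar_mxM -raddfD /= mul1r divfK // addNr.
  exact: raddf0.
rewrite mul_col_row -!scalar_mxM !mulr1; congr (block_mx _ _%:M _ _%:M \in V): Vw.
  apply: (mulIf nzc); rewrite mulrA divfK //; apply/eqP.
  by rewrite -subr_eq0 -[X in _ == X]det0; apply/eqP; ring.
by rewrite mulrCA mulfV ?mulr1.
Qed.

Lemma rank_one_exists k (V : {vspace 'M[K]_(1 + k.+2)}) :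
  one_eigen_space f V ->
  (forall p : 'rV[K]_k.+2, (forall v, v \in V -> p *m dlsubmx v = 0) ->
     block_mx 0 p 0 0 \in V) ->
  (forall N : 'M[K]_k.+2, strictly_upper N -> exists l, block_mx 0 l 0 N \in V) ->
  (forall p : 'rV[K]_k.+2, block_mx 0 p 0 0 \in V -> p = 0) ->
  exists (x : 'cV[K]_(1 + k.+2)) (p : 'rV[K]_(1 + k.+2)),
    [/\ x != 0, p != 0, p *m x = 0 & x *m p \in V].
Proof.
move=> QV annV liftV X0; pose top : 'I_k.+2 := ord_max.
pose E : 'M[K]_k.+2 := delta_mx 0 top.
have suE : strictly_upper E by apply: strictly_upper_delta.
have [l Vu] := liftV E suE; set u := block_mx 0 l 0 E in Vu.
have tr0 q (N : 'M[K]_k.+2) : strictly_upper N ->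
    \tr (block_mx (0 : 'M_1) q 0 N) = 0.
  move=> suN; rewrite mxtrace_block linear0 add0r /mxtrace big1 // => i _.
  exact: suN.
have mulE (a : 'rV[K]_k.+2) j : (a *m E) 0 j = a 0 0 * (j == top)%:R.
  rewrite mxE (bigD1 0) //= mxE eqxx andTb big1 ?addr0 // => i ni0.
  by rewrite mxE (negPf ni0) mulr0.
(* The identity tr((v u + u v) z) = 0 says that the top right part of u z + z u
   is orthogonal to all the lower left columns. *)
have jordan a (N : 'M[K]_k.+2) : strictly_upper N -> block_mx 0 a 0 N \in V ->
    l *m N + a *m E = 0.
  move=> suN VN; set z := block_mx _ _ _ _ in VN; apply/X0/annV => v Vv.
  have EN : E *m N = 0.
    apply/matrixP=> i j; rewrite !mxE big1 // => h _; rewrite mxE.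
    by case: (eqVneq h top) => [-> | _]; rewrite ?andbF ?mul0r // suN ?mulr0 // -ltnS.
  have NE : N *m E = 0.
    apply/matrixP=> i j; rewrite !mxE big1 // => h _; rewrite mxE.
    by case: (eqVneq h 0) => [-> | _]; rewrite ?mul0r ?mulr0 // suN ?mul0r.
  have := one_eigen_trace3_polar nz2 nz3 QV Vv Vu VN (tr0 a N suN).
  rewrite mulmxDl mxtraceD [X in _ + X]mxtrace_mulC [z *m _]mulmxA.
  rewrite [X in _ + X]mxtrace_mulC -mulmxA -mxtraceD -mulmxDr.
  rewrite !mulmx_block !(mulmx0, mul0mx, addr0, add0r) EN NE add_block_mx !addr0.
  by rewrite mxtrace_topright => e; apply/rowP=> i; rewrite ord1 e mxE.
have half c : c + c = 0 -> c = 0 :> K.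
  by move=> /eqP; rewrite -mulr2n -mulr_natl mulf_eq0 (negPf nz2) => /eqP.
have l0 : l 0 0 = 0.
  have := jordan l E suE Vu => /rowP/(_ top); rewrite mxE !mulE eqxx mulr1 mxE.
  exact: half.
pose prev : 'I_k.+2 := inord k.
have prevE : prev = k :> nat by rewrite inordK.
have l_low (i : 'I_k.+2) : (i < k)%N -> l 0 i = 0.
  move=> lt_ik; have lt_ip : (i < prev)%N by rewrite prevE.
  have suN := strictly_upper_delta K lt_ip.
  have [a Va] := liftV _ suN.
  have := jordan a _ suN Va => /rowP/(_ prev); rewrite mxE mulE mxE.
  rewrite (bigD1 i) //= mxE !eqxx mulr1 big1 ?addr0; last first.
    by move=> h nhi; rewrite mxE (negPf nhi) mulr0.
  have -> : prev == top = false by rewrite -val_eqE /= prevE; lia.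
  by rewrite mulr0 addr0 mxE.
have uu : u *m u = 0.
  rewrite mulmx_block !(mulmx0, mul0mx, addr0, add0r).
  have -> : l *m E = 0 by apply/rowP=> j; rewrite mulE l0 mul0r mxE.
  by rewrite mul_delta_mx_0 ?block_mx0.
have tru := tr0 l E suE.
have l_prev : l 0 prev = 0.
  have [|v Vv dv] := column_saturated annV (x := delta_mx prev 0).
    by move=> p /X0 ->; rewrite mul0mx.
  have := one_eigen_trace4_polar nz2 nz3 QV Vu Vv Vv Vu tru.
  have e1 (a b : 'M[K]_(1 + k.+2)) : \tr (u *m a *m b *m u) = 0.
    by rewrite mxtrace_mulC !mulmxA uu !mul0mx mxtrace0.
  have e2 (a b : 'M[K]_(1 + k.+2)) : \tr (a *m b *m u *m u) = 0.
    by rewrite -mulmxA uu mulmx0 mxtrace0.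
  rewrite !mulmxDl !mxtraceD !e1 !e2 !add0r !addr0 => /half.
  rewrite mxtrace_mulC !mulmxA => tr_uvuv.
  have truv := one_eigen_trace2 nz2 QV Vv Vu tru; rewrite mxtrace_mulC in truv.
  have uv : u *m v = block_mx (l 0 prev)%:M (l *m drsubmx v) 0 (E *m drsubmx v).
    rewrite -{1}[v]submxK mulmx_block !mul0mx !add0r -dv; congr block_mx.
      rewrite [LHS]mx11_scalar; congr (_%:M); rewrite mxE (bigD1 prev) //= mxE !eqxx.
      by rewrite mulr1 big1 ?addr0 // => h nh; rewrite mxE (negPf nh) mulr0.
    by rewrite mul_delta_mx_0 // -val_eqE /= prevE; lia.
  have trEC (C : 'M[K]_k.+2) : \tr (E *m C) = C top 0.
    rewrite /mxtrace (bigD1 0) //= big1 ?addr0 => [|i ni0]; rewrite mxE.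
      rewrite (bigD1 top) //= mxE !eqxx mul1r big1 ?addr0 // => h nh.
      by rewrite mxE (negPf nh) mul0r.
    by rewrite big1 // => h _; rewrite mxE (negPf ni0) mul0r.
  have CEC (C : 'M[K]_k.+2) : (C *m (E *m C)) top 0 = C top 0 ^+ 2.
    rewrite mxE (bigD1 0) //= big1 ?addr0 => [|i ni0]; last first.
      by rewrite mxE big1 ?mulr0 // => h _; rewrite mxE (negPf ni0) mul0r.
    rewrite mxE (bigD1 top) //= mxE !eqxx mul1r big1 ?addr0 // => h nh.
    by rewrite mxE (negPf nh) mul0r.
  move: truv tr_uvuv; rewrite -[u *m v *m u *m v]mulmxA uv mulmx_block.
  rewrite !mul0mx !mulmx0 !addr0 !add0r !mxtrace_block -mulmxA !trEC CEC.
  rewrite -scalar_mxM !mxtrace_scalar !mulr1n => /eqP.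
  rewrite addr_eq0 eq_sym eqr_oppLR => /eqP ->; rewrite sqrrN -expr2 => /half/eqP.
  by rewrite expf_eq0 => /eqP.
have defl : l = l 0 top *: delta_mx 0 top.
  apply/rowP=> j; rewrite !mxE eqxx /=; case: (eqVneq j top) => [-> | nj].
    by rewrite mulr1.
  rewrite mulr0; case: (ltngtP j k) => [/l_low // | lt_kj | eq_jk].
    by case/eqP: nj; apply: val_inj; apply/eqP; rewrite eqn_leq -ltnS ltn_ord.
  by rewrite -l_prev; congr (l 0 _); apply: val_inj; rewrite /= prevE.
have defu : u = col_mx (l 0 top)%:M (delta_mx 0 0) *m row_mx 0 (delta_mx 0 top).
  by rewrite mul_col_row !mulmx0 mul_scalar_mx -defl mul_delta_mx.
exists (col_mx (l 0 top)%:M (delta_mx 0 0)), (row_mx 0 (delta_mx 0 top)); split.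
- rewrite col_mx_eq0; apply/nandP; right; apply/eqP=> /matrixP/(_ 0 0)/eqP.
  by rewrite !mxE oner_eq0.
- rewrite row_mx_eq0; apply/nandP; right; apply/eqP=> /matrixP/(_ 0 top)/eqP.
  by rewrite !mxE !eqxx oner_eq0.
- by rewrite mul_row_col mul0mx add0r mul_delta_mx_0.
- by rewrite -defu.
Qed.

End RankOneExistence.

Lemma topright_dichotomy (K : fieldType) m (V : {vspace 'M[K]_(1 + m)}) :
  (exists2 p : 'rV[K]_m, p != 0 & block_mx 0 p 0 0 \in V) \/
  (forall p : 'rV[K]_m, block_mx 0 p 0 0 \in V -> p = 0).
Proof.
pose h (p : 'rV[K]_m) : 'M[K]_(1 + m) := block_mx 0 p 0 0.
have lin_h : linear h.
  by move=> a p q; rewrite /h scale_block_mx add_block_mx !scaler0 !addr0.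
pose hl : {linear 'rV[K]_m -> 'M[K]_(1 + m)} :=
  HB.pack h (GRing.isLinear.Build K _ _ _ h lin_h).
pose Y := (linfun hl @^-1: V)%VS.
have memY p : (p \in Y) = (h p \in V) by rewrite -memv_preim lfunE.
have [Y0 | nzY] := eqVneq Y 0%VS.
  by right=> p Vp; apply/eqP; rewrite -memv0 -Y0 memY.
by left; exists (vpick Y); rewrite ?vpick0 // -/(h _) -memY memv_pick.
Qed.

Lemma dim_bound (K : fieldType) (L : closedFieldType) (f : {rmorphism K -> L})
    (nz2 : 2%:R != 0 :> K) (nz3 : 3%:R != 0 :> K) n : dim_bound_at f n.
Proof.
have [N le_nN] := ubnP n; elim: N n le_nN => // N IH [|m] le_nN V QV.
  split=> [|_]; first by rewrite (leq_trans (dimvS (subvf V))) // dimvf.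
  by exists 1%:M; split=> [|M _ []]; rewrite ?unitmx1.
have boundm k : (k <= m)%N -> dim_bound_at f k.
  by move=> le_km; apply: IH; exact: leq_ltn_trans le_km le_nN.
have [leV _] := first_column_analysis (V := V) nz2 QV (boundm m (leqnn m)).
split=> // dV; have [[p nzp Vp] | X0] := @topright_dichotomy K m V.
  exact: (topright_triangularizable nz2 nz3 boundm QV dV nzp Vp).
case: m => [|[|k]] in V QV le_nN boundm leV dV X0 *.
- by exists 1%:M; split=> [|M _ i j]; rewrite ?unitmx1 // !ord1.
- have [x [p [nzx nzp px Vxp]]] := rank_one_size2 nz2 QV dV X0.
  exact: (rank_one_triangularizable nz2 nz3 boundm QV dV nzx nzp px Vxp).
have [R [P [uR uP conjR annW liftW]]] := flag_coordinates nz2 boundm QV dV.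
have QW := one_eigen_conjv uR QV.
have dW : \dim (conjv R V) = 'C(k.+3, 2).+1 by rewrite dimv_conjv.
apply: (triangularizable_conjv uR).
have W0 (p : 'rV[K]_k.+2) : block_mx 0 p 0 0 \in conjv R V -> p = 0.
  rewrite memv_conjv // -[p](mulmxKV uP) -conjR conjmK // => /X0 ->.
  by rewrite !mul0mx.
have [x [p [nzx nzp px Wxp]]] := rank_one_exists nz2 nz3 QW annW liftW W0.
exact: (rank_one_triangularizable nz2 nz3 boundm QW dW nzx nzp px Wxp).
Qed.

(** * Uniqueness *)

Lemma strictly_upper_nil_eigen (K : fieldType) (L : closedFieldType)
    (f : {rmorphism K -> L}) n (N : 'M[K]_n) : strictly_upper N -> nil_eigen f N.
Proof.
move=> /strictly_upperP [uN N0] a.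
rewrite char_poly_upper // rmorph_prod /= => /eqP.
rewrite horner_prod => /eqP/prodf_eq0 [i _].
by rewrite map_polyXsubC hornerXsubC N0 rmorph0 subr0 => /eqP.
Qed.

Lemma flag_stabilizer_upper (K : fieldType) n (P : 'M[K]_n) : P \in unitmx ->
  (forall N, strictly_upper N -> strictly_upper (conjm P N)) -> upper P.
Proof.
move=> uP suP i; have [k] := ubnP (n - i)%N; elim: k i => // k IH i le_ik a lt_ai.
pose N := conjm P (delta_mx a i).
have suN : strictly_upper N by apply/suP/strictly_upper_delta.
have : (P *m delta_mx a i) i i = (N *m P) i i by rewrite /N /conjm mulmxKV.
rewrite [LHS]mxE (bigD1 a) //= mxE !eqxx mulr1 big1 ?addr0 => [->|j nja]; last first.
  by rewrite mxE (negPf nja) mulr0.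
rewrite mxE big1 // => c _; have [le_ci | lt_ic] := leqP c i.
  by rewrite suN ?mul0r.
by rewrite (IH c) ?mulr0 //; have := ltn_ord c; lia.
Qed.

Lemma upper_unit_diag (K : fieldType) n (P : 'M[K]_n) i : P \in unitmx -> upper P -> P i i != 0.
Proof.
move=> uP upP; move: uP; rewrite unitmxE -det_tr det_trig; last first.
  by apply/is_trig_mxP => j k /upP; rewrite mxE.
by rewrite unitfE => /prodf_neq0/(_ i isT); rewrite mxE.
Qed.

Lemma inV1star_inj (K : fieldType) (L : closedFieldType)
    (f : {rmorphism K -> L}) n (I J : {set 'I_n}) (P : 'M[K]_n) : I != set0 ->
  P \in unitmx -> (forall A, inV1star I A -> inV1star J (conjm P A)) -> I = J.
Proof.
move=> /set0Pn [i0 Ii0] uP IJ.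
have upV (I' : {set 'I_n}) (A : 'M[K]_n) : inV1star I' A -> upper A.
  move=> [c [N [suN ->]]] i j lt_ji; rewrite mxE scaler_DI suN ?(ltnW lt_ji) //.
  by rewrite -val_eqE /= gtn_eqF // mulr0 addr0.
have suP N : strictly_upper N -> strictly_upper (conjm P N).
  move=> suN; apply: (nil_eigen_upper (f := f)).
    by apply: (upV J); apply: IJ; exists 0, N; rewrite scale0r add0r.
  exact/nil_eigen_conjm/strictly_upper_nil_eigen.
have upP := flag_stabilizer_upper uP suP.
pose D : 'M[K]_n := 1 *: DI K I.
have ID : inV1star I D by exists 1, 0; split; rewrite ?addr0 // => i j _; rewrite mxE.
have [c [N [suN eD]]] := IJ D ID.
have eI i : (i \in I)%:R = c * (i \in J)%:R :> K.
  apply: (mulIf (upper_unit_diag i uP upP)).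
  have : (P *m D) i i = (conjm P D *m P) i i by rewrite /conjm mulmxKV.
  rewrite mxE (bigD1 i) //= scaler_DI eqxx mul1r big1 => [|j nji]; last first.
    by rewrite scaler_DI (negPf nji) !mulr0.
  rewrite addr0 mulrC => ->; rewrite mxE (bigD1 i) //= big1 => [|j nji].
    by rewrite addr0 eD mxE scaler_DI eqxx suN // addr0.
  case: (ltngtP j i) => [lt_ji | lt_ij | /val_inj eq_ji].
  - by rewrite (upV J _ (IJ D ID)) ?mul0r.
  - by rewrite upP ?mulr0.
  - by rewrite eq_ji eqxx in nji.
have nzc : c != 0.
  by apply/eqP=> c0; have /eqP := eI i0; rewrite Ii0 c0 mul0r oner_eq0.
apply/setP=> i; have := eI i; case: (i \in I) (i \in J) => [] [] //=.
  by rewrite mulr0 => /eqP; rewrite oner_eq0.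
by rewrite mulr1 => /esym/eqP; rewrite (negPf nzc).
Qed.

Theorem mainTheorem4 (K : fieldType) (L : closedFieldType) (f : {rmorphism K -> L})
    (n : nat) (V : {vspace 'M[K]_n}) :
  ~ (2%N \in [pchar K]) -> ~ (3%N \in [pchar K]) ->
  is_alg_closure f ->
  (0 < n)%N ->
  \dim V = 'C(n, 2).+1 ->
  (forall M : 'M[K]_n, M \in V ->
     forall a b : L, a != 0 -> b != 0 ->
       eigenvalue (map_mx f M) a -> eigenvalue (map_mx f M) b -> a = b) ->
  exists! I : {set 'I_n}, I != set0 /\ subspace_similar_to V (inV1star I).
Proof.
move=> char2 char3 _ _ dV eigV.
have nz2 : 2%:R != 0 :> K by apply/negP=> e2; apply: char2; rewrite inE /= e2.
have nz3 : 3%:R != 0 :> K by apply/negP=> e3; apply: char3; rewrite inE /= e3.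
have QV : one_eigen_space f V.
  move=> M VM a b nza nzb; rewrite !map_char_poly -!eigenvalue_root_char.
  exact: eigV.
have [_ triV] := dim_bound nz2 nz3 QV.
have [P [I [uP nI memI]]] := max_space nz2 QV dV (triV dV).
exists I; split; first by split=> //; exists P.
move=> J [nJ [R [uR memJ]]].
apply: (@inV1star_inj K L f n I J (R *m invmx P)) => //.
  by rewrite unitmx_mul uR unitmx_inv.
move=> A IA; rewrite -conjm_comp ?unitmx_inv //; apply/memJ/memI.
by rewrite conjmVK.
Qed.
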